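(* Let $(V,\psi)$ be a rational, polarized, pure Hodge structure of weight $n$ with polarization $\psi\colon V\times V\to\mathbb{Q}(-n)$. Let $\mathrm{MT}(V,\psi)$ be its Mumford--Tate group, $\mathrm{DH}(V,\psi):=\mathrm{MT}(V,\psi)\cap \mathrm{Iso}_{(V,\psi)}$ and $\mathrm{H}(V,\psi):=\mathrm{DH}(V,\psi)^{\circ}$ its Hodge group. Then: (a) $\mathbb{G}_m\mathrm{Id}_V\cdot \mathrm{H}(V,\psi)=\mathbb{G}_m\mathrm{Id}_V\cdot \mathrm{DH}(V,\psi)=\mathrm{MT}(V,\psi)$. (b) $\mathrm{DH}(V,\psi)=\mathrm{H}(V,\psi)\cup -\mathrm{Id}_V\cdot \mathrm{H}(V,\psi)$. (c) $-\mathrm{Id}_V\in \mathrm{H}(V,\psi)$ if and only if $\mathrm{H}(V,\psi)=\mathrm{DH}(V,\psi)$. (d) If $n$ is odd, then $-\mathrm{Id}_V\in \mathrm{H}(V,\psi)=\mathrm{DH}(V,\psi)$.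
   Context: $\mathrm{GIso}_{(V,\psi)}$ is the algebraic group over $\mathbb{Q}$ of all $g\in \mathrm{GL}_V$ for which there is $\chi(g)\in\mathbb{G}_m$ with $\psi(gv,gw)=\chi(g)\psi(v,w)$ for all $v,w\in V$; $\chi$ is a character of it, and $\mathrm{Iso}_{(V,\psi)}$ is its subgroup of $g$ with $\psi(gv,gw)=\psi(v,w)$ for all $v,w$. Let $\mu_{\infty,V}\colon \mathbb{G}_m(\mathbb{C})\to \mathrm{GL}(V_{\mathbb{C}})$ be the cocharacter for which $\mu_{\infty,V}(z)$ acts on $V^{p,n-p}$ as multiplication by $z^{-p}$. $\mathrm{MT}(V,\psi)$ is the smallest algebraic subgroup of $\mathrm{GIso}_{(V,\psi)}$ over $\mathbb{Q}$ whose $\mathbb{C}$-points contain $\mu_{\infty,V}(\mathbb{C}^{\times})$. In this setting one has $\mathbb{G}_m\mathrm{Id}_V\subseteq\mathrm{MT}(V,\psi)$, by the definition of a rational Hodge structure. The superscript $\circ$ denotes the identity component.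
   Formalization: In weight n = 0 the inclusion of G_m Id_V in MT(V,ψ) is taken as a hypothesis: it fails there unless V = 0, and the statement is then false (e.g. V = Q(0), where MT = DH = H = 1); for n ≠ 0 nothing is added. *)

(* Defs.v *)
From HB Require Import structures.
From mathcomp Require Import all_boot all_order all_algebra.
From mathcomp Require Import complex.
From mathcomp Require Import boolp classical_sets reals topology.
From mathcomp Require Import mpoly.

Set Implicit Arguments.
Unset Strict Implicit.
Unset Printing Implicit Defensive.

Import Order.TTheory GRing.Theory Num.Theory.

Local Open Scope classical_set_scope.
Local Open Scope ring_scope.

Definition mxeval (K : fieldType) (d : nat) (p : {mpoly K[d * d]})
    (g : 'M[K]_d) : K :=
  p.@[mxvec g 0].

Section Zariski.
Variables (K : fieldType) (d : nat).

(* 'M[K]_d with the Zariski topology of affine space. The subspace topology it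
   induces on GL_d(K) is the Zariski topology of the affine variety GL_d. *)
Definition zariski : Type := 'M[K]_d.
HB.instance Definition _ := Choice.on zariski.

Definition zariski_open (U : set zariski) : Prop :=
  exists S : set ({mpoly K[d * d]}), U = [set g | exists2 p, S p & mxeval p g != 0].

Let openT : zariski_open setT.
Proof.
exists [set 1]; apply/seteqP; split=> g //= _.
by exists 1 => //; rewrite /mxeval meval1 oner_neq0.
Qed.

Let openI (U W : set zariski) :
  zariski_open U -> zariski_open W -> zariski_open (U `&` W).
Proof.
move=> [S ->] [T ->].
exists [set r | exists p q, [/\ S p, T q & r = p * q]].
apply/seteqP; split=> g /=.
  move=> [[p Sp pg] [q Tq qg]]; exists (p * q); first by exists p, q.
  by rewrite /mxeval mevalM mulf_neq0.
move=> [r [p [q [Sp Tq ->]]]]; rewrite /mxeval mevalM mulf_eq0 negb_or.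
by move=> /andP[pg qg]; split; [exists p | exists q].
Qed.

Let open_bigU (I : Type) (f : I -> set zariski) :
  (forall i, zariski_open (f i)) -> zariski_open (\bigcup_i f i).
Proof.
move=> /choice[S fS]; exists (\bigcup_i S i); apply/seteqP; split=> g /=.
  by move=> [i _]; rewrite fS => -[p Sp pg]; exists p => //; exists i.
by move=> [p [i _ Sp] pg]; exists i => //; rewrite fS; exists p.
Qed.

HB.instance Definition _ :=
  isOpenTopological.Build zariski openT openI open_bigU.

End Zariski.

Section MatrixSets.
Variables (K : fieldType) (d : nat).
Implicit Types A B : set 'M[K]_d.

Definition mulset A B : set 'M[K]_d := [set a *m b | a in A & b in B].

Definition Gm_Id : set 'M[K]_d := [set t%:M | t in [set t : K | t != 0]].

(* Meaningful when A is a Zariski closed subgroup of GL_d(K). *)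
Definition identity_component A : set 'M[K]_d :=
  connected_component (A : set (zariski K d)) (1%:M : zariski K d).

End MatrixSets.

Arguments Gm_Id {K d}.

(* An algebraic subgroup of GL_d over Q is smooth, hence determined by its group
   of complex points, and the groups arising in this way are the subgroups of
   GL_d(C) cut out by polynomials with rational coefficients. *)
Definition algebraic_subgroupQ (R : realType) (d : nat) (G : set 'M[R[i]]_d) :
    Prop :=
  [/\ G 1%:M,
      (forall g h, G g -> G h -> G (g *m h)),
      (forall g, G g -> G (invmx g)) &
      exists S : set ({mpoly rat[d * d]}),
        G = [set g | g \in unitmx /\
                     forall p, S p -> mxeval (map_mpoly ratr p) g = 0]].

Section Complexification.
Variables (R : realType) (V : vectType rat).
Local Notation C := R[i].

(* V (x) C and End(V (x) C), in the coordinates given by the rational basis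
   vbasis {:V} of V; complex conjugation on V (x) C is then entrywise. *)
Definition VC := 'cV[C]_(\dim {:V}).
Definition EndVC := 'M[C]_(\dim {:V}).

Definition conjVC (v : VC) : VC := map_mx Num.conj v.

Definition gram (psi : {biscalar V}) : 'M[rat]_(\dim {:V}) :=
  \matrix_(i, j) psi (tnth (vbasis {:V}) i) (tnth (vbasis {:V}) j).

Definition formC (psi : {biscalar V}) (v w : VC) : C :=
  (v^T *m map_mx ratr (gram psi) *m w) 0 0.

(* hodge_part p is V^{p,n-p}. *)
Record hodge_structure (n : int) := HodgeStructure {
  hodge_part :> int -> {vspace VC};
  hodge_decomposition : exists s : seq int,
    [/\ uniq s,
        forall p, p \notin s -> hodge_part p = 0%VS,
        directv (\sum_(p <- s) hodge_part p) &
        (\sum_(p <- s) hodge_part p)%VS = fullv];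
  hodge_symmetry : forall p v,
    v \in hodge_part p -> conjVC v \in hodge_part (n - p)
}.

Section Polarized.
Variables (n : int) (H : hodge_structure n) (psi : {biscalar V}).

(* Q(-n) is identified with Q by means of its generator (2 pi i)^-n. The second
   clause says that psi is a morphism V (x) V -> Q(-n) of Hodge structures. The
   third one is positivity of psi(v, h(i) (conj v)) on V^{p,n-p}, with h(z)
   acting on V^{p,q} by z^-p (conj z)^-q. *)
Definition polarization : Prop :=
  [/\ (forall v w, psi w v = (-1) ^ n * psi v w),
      (forall p q v w, v \in H p -> w \in H q -> p + q != n ->
         formC psi v w = 0) &
      (forall p v, v \in H p -> v != 0 ->
         0 < 'i ^ (p - (n - p)) * formC psi v (conjVC v))].

Definition GIso : set EndVC :=
  [set g | g \in unitmx /\ exists2 chi : C, chi != 0 &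
     forall v w, formC psi (g *m v) (g *m w) = chi * formC psi v w].

Definition Iso : set EndVC :=
  [set g | g \in unitmx /\
     forall v w, formC psi (g *m v) (g *m w) = formC psi v w].

(* mu z g says that g is the value at z of the cocharacter mu_{oo,V}; the
   Hodge decomposition makes this g exist and be unique. *)
Definition mu (z : C) (g : EndVC) : Prop :=
  forall p v, v \in H p -> g *m v = z ^ (- p) *: v.

Definition mu_image : set EndVC := [set g | exists2 z, z != 0 & mu z g].

(* For a polarization psi, GIso itself belongs to the family, and the family is
   stable under intersection, so MT is its smallest member. For n != 0, MT
   contains the homotheties: MT is stable under entrywise complex conjugation,
   and mu z times the conjugate of mu (conj z) is the homothety z ^ (- n). For
   n = 0 one has MT `<=` Iso, so this fails unless V = 0. *)
Definition MT : set EndVC :=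
  \bigcap_(G in [set G | [/\ algebraic_subgroupQ G, G `<=` GIso &
                             mu_image `<=` G]]) G.

Definition DH : set EndVC := MT `&` Iso.

Definition Hg : set EndVC := identity_component DH.

End Polarized.
End Complexification.

(* Main.v *)
Require Import Defs.
From mathcomp Require Import all_boot all_order all_algebra.
From mathcomp Require Import separable ring.
From mathcomp Require Import complex boolp classical_sets reals topology.
From mathcomp Require Import mpoly.

(* With lam z acting on V^{p,n-p} as z^(n-2p), one has mu(z^2) = z^(-n) lam(z), and lam takes
   its values in DH. A connected algebraic subgroup D of DH over Q containing the image of lam
   is obtained as the Zariski closure of the group generated by all cocharacters of DH with the
   weights of lam. It is defined over Q because a point of C^N at which a rational polynomial
   does not vanish can be specialized, respecting all its polynomial relations over Q, to a
   point where a given combination of rational polynomials with Q-linearly independent complex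
   coefficients does not vanish; this replaces the action of Aut(C).
   Next, Gm.D is again defined over Q: for f vanishing on D, f(g/s) f(-g/s) is a polynomial in
   g and s^2 = chi(g). As Gm.D contains the image of mu, MT = Gm.D, whence DH is the union of D
   and -D. Finally D lies in Hg, and lam(-1) = (-1)^n. *)

Set Implicit Arguments.
Unset Strict Implicit.
Unset Printing Implicit Defensive.

Import Order.TTheory GRing.Theory Num.Theory.
Import Defs.

Local Open Scope classical_set_scope.
Local Open Scope ring_scope.

(** * Specialization of complex points over Q *)

Lemma ex_argmin (T : Type) (P : T -> Prop) (f : T -> nat) (x0 : T) :
  P x0 -> exists2 x, P x & forall y, P y -> (f x <= f y)%N.
Proof.
move=> Px0.
have ex_n : exists n, `[< exists2 x, P x & f x = n >].
  by exists (f x0); apply/asboolP; exists x0.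
case: (ex_minnP ex_n) => n /asboolP[x Px <-] min_n; exists x => // y Py.
by apply: min_n; apply/asboolP; exists y.
Qed.

Section Generic.
Variable C : numClosedFieldType.

Definition rat_free (r : nat) (c : 'I_r -> C) : Prop :=
  forall q : 'I_r -> rat, \sum_j c j * ratr (q j) = 0 -> forall j, q j = 0.

(* The specializations psi of phi are enough to detect, in C (x)_Q phi(A), the tensors
   \sum_j c j (x) phi (b j); the c j being free, such a tensor is nonzero as soon as one
   phi (b j) is. *)
Definition generic_point (A : idomainType) (phi : {rmorphism A -> C}) : Prop :=
  forall (r : nat) (c : 'I_r -> C) (b : 'I_r -> A) (j0 : 'I_r),
    rat_free c -> phi (b j0) != 0 ->
    exists psi : {rmorphism A -> C},
      (forall a, phi a = 0 -> psi a = 0) /\ \sum_j c j * psi (b j) != 0.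

Lemma generic_point_rat : generic_point (ratr : {rmorphism rat -> C}).
Proof.
move=> r c b j0 cfree bj0; exists (ratr : {rmorphism rat -> C}); split=> //.
by apply: contra bj0 => /eqP/cfree ->; rewrite rmorph0.
Qed.

Definition horner_at (A : idomainType) (f : {rmorphism A -> C}) (x : C) :
    {rmorphism {poly A} -> C} :=
  horner_morph (fun a => mulrC x (f a)).

Lemma horner_atE (A : idomainType) (f : {rmorphism A -> C}) x p :
  horner_at f x p = (map_poly f p).[x].
Proof. by []. Qed.

Section Adjoin.
Variables (A : idomainType) (phi : {rmorphism A -> C}).

(** As [phi] may kill leading coefficients, a polynomial is truncated to the size of its image; when
    the image is nonzero, the new leading coefficient survives [phi], as pseudo-division
    requires. *)
Lemma trim_poly (p : {poly A}) :
  exists2 q, map_poly phi q = map_poly phi p & size q = size (map_poly phi p).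
Proof.
pose q := take_poly (size (map_poly phi p)) p.
have qp : map_poly phi q = map_poly phi p.
  apply/polyP=> i; rewrite !coef_map coef_take_poly; case: ltnP => // le_i.
  by rewrite raddf0 -coef_map nth_default.
exists q => //; apply/eqP; rewrite eqn_leq size_take_poly /=.
by rewrite -qp size_poly.
Qed.

Lemma map_poly_ker (psi : {rmorphism A -> C}) p :
  (forall a, phi a = 0 -> psi a = 0) -> map_poly phi p = 0 -> map_poly psi p = 0.
Proof.
move=> ker p0; apply/polyP=> i; rewrite coef_map coef0; apply: ker.
by rewrite -coef_map p0 coef0.
Qed.

Lemma coef_neq0 (K : nzRingType) (p : {poly K}) : p != 0 -> exists i, p`_i != 0.
Proof. by move=> p0; exists (size p).-1; rewrite -lead_coefE lead_coef_eq0. Qed.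

Lemma ex_nonroot (p : {poly C}) : p != 0 -> exists y, p.[y] != 0.
Proof.
move=> p0; apply: contrapT => /forallNP all_root.
suff: (size p < size p)%N by rewrite ltnn.
have := @max_poly_roots _ p [seq i%:R | i <- iota 0 (size p)] p0.
rewrite size_map size_iota; apply.
  by apply/allP=> y _; apply/negPn/negP; exact: all_root.
rewrite map_inj_uniq ?iota_uniq //.
by move=> i j /eqP; rewrite eqr_nat => /eqP.
Qed.

(** A relation at [x] holds coefficient by coefficient. So a specialization of [A] that keeps one
    coefficient of the combination nonzero extends by sending ['X] to any non-root [y] of the
    resulting polynomial. *)
Lemma adjoin_transcendental (x : C) : generic_point phi ->
  (forall p, (map_poly phi p).[x] = 0 -> map_poly phi p = 0) ->
  generic_point (horner_at phi x).
Proof.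
move=> gen trx r c b j0 cfree bj0.
have /coef_neq0[k] : map_poly phi (b j0) != 0.
  by apply: contra bj0 => /eqP; rewrite horner_atE => ->; rewrite horner0.
rewrite coef_map => bk0.
have [psi [ker sum0]] := gen r c (fun j => (b j)`_k) j0 cfree bk0.
pose p := \sum_j c j *: map_poly psi (b j).
have /ex_nonroot[y py0] : p != 0.
  apply: contra sum0 => /eqP p0; have := congr1 (fun q : {poly C} => q`_k) p0.
  rewrite coef0 coef_sum => pk0; rewrite -[X in _ == X]pk0; apply/eqP.
  by apply: eq_bigr => j _; rewrite coefZ coef_map.
exists (horner_at psi y); split=> [q|].
  rewrite !horner_atE => /trx q0; rewrite (map_poly_ker ker q0).
  by rewrite horner0.
apply: contra py0 => /eqP s0; rewrite /p horner_sum -[X in _ == X]s0; apply/eqP.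
by apply: eq_bigr => j _; rewrite hornerZ horner_atE.
Qed.

(** * Adjoining an element that is algebraic over the image of [phi] *)

Section Algebraic.
Variables (x : C) (m : {poly A}).
(** Up to a factor, [map_poly phi m] is the minimal polynomial of [x] over the fraction field of the
    image of [phi]; [m_size] keeps [phi] from killing the leading coefficient. *)
Hypothesis m_size : size m = size (map_poly phi m).
Hypothesis m_neq0 : map_poly phi m != 0.
Hypothesis m_root : (map_poly phi m).[x] = 0.
Hypothesis m_min : forall p, (map_poly phi p).[x] = 0 ->
  (size (map_poly phi p) < size m)%N -> map_poly phi p = 0.

Lemma trimmed_lead (q : {poly A}) : size q = size (map_poly phi q) ->
  map_poly phi q != 0 -> phi (lead_coef q) != 0.
Proof.
move=> sz q0; rewrite lead_coefE sz -coef_map -lead_coefE lead_coef_eq0.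
exact: q0.
Qed.

Lemma size_map_le (p : {poly A}) : (size (map_poly phi p) <= size p)%N.
Proof. exact: size_poly. Qed.

Lemma minimal_size_gt1 : (1 < size m)%N.
Proof.
rewrite ltnNge; apply/negP; rewrite m_size => /size1_polyC mc.
move: m_root m_neq0; rewrite mc hornerC => ->.
by rewrite polyC0 eqxx.
Qed.

(* The gcd of m and its derivative over the fraction field of phi(A) has smaller
   degree than m, hence does not vanish at x, hence is a constant. *)
Lemma minimal_bezout : exists u v d,
  map_poly phi (u * m + v * m^`()) = (phi d)%:P /\ phi d != 0.
Proof.
pose I (q : {poly A}) := map_poly phi q != 0 /\
  exists u v, map_poly phi q = map_poly phi (u * m + v * m^`()).
have dm_neq0 : map_poly phi m^`() != 0.
  rewrite -deriv_map; apply/eqP => dm0.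
  have := congr1 (fun q : {poly C} => q`_(size m).-2) dm0.
  have := minimal_size_gt1; case Em: (size m) => [|[|k]] //= _.
  move/eqP; rewrite coef_deriv coef0 -mulr_natr mulf_eq0 pnatr_eq0 orbF.
  have -> : k.+1 = (size (map_poly phi m)).-1 by rewrite -m_size Em.
  by rewrite -lead_coefE lead_coef_eq0; apply/negP.
have Idm : I m^`() by split=> //; exists 0, 1; rewrite mul0r mul1r add0r.
have [q0 [q0_neq0 [u [v q0E]]] q0_min] :=
  ex_argmin (fun q => size (map_poly phi q)) Idm.
have [q qE q_size] := trim_poly q0.
have q_neq0 : map_poly phi q != 0 by rewrite qE.
have lq0 : phi (lead_coef q) != 0 by apply: trimmed_lead; rewrite ?q_size ?qE.
have q_min p : I p -> (size q <= size (map_poly phi p))%N.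
  by rewrite q_size; exact: q0_min.
have nrx : (map_poly phi q).[x] != 0.
  apply/eqP => /m_min q_small; move/eqP: q_neq0; apply; apply: q_small.
  rewrite qE -q_size (leq_ltn_trans (q_min _ Idm)) //.
  rewrite (leq_ltn_trans (size_map_le _)) // lt_size_deriv //.
  by apply: contraNneq m_neq0 => ->; rewrite rmorph0.
have := Pdiv.Idomain.divp_eq m q.
set a := _ ^+ _; set w := m %/ q; set t := m %% q => divE.
(* The remainder is again a combination of [m] and its derivative, and too short to have nonzero
   image, by the minimal choice of [q]. *)
have t0 : map_poly phi t = 0.
  apply: contrapT => /eqP t0.
  have : (size q <= size t)%N.
    apply: leq_trans (size_map_le t); apply: q_min; split=> //.
    exists (a%:P - w * u), (- (w * v)).
    have -> : t = a *: m - w * q by rewrite divE addrC addKr.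
    transitivity (map_poly phi (a *: m - w * (u * m + v * m^`()))).
      by rewrite !rmorphB !rmorphM /= qE q0E.
    by congr map_poly; rewrite -mul_polyC mulrBl mulrDr !mulrA mulNr opprD !addrA.
  rewrite leqNgt ltn_modp => /negP[].
  by apply: contraNneq q_neq0 => ->; rewrite rmorph0.
have wqE : phi a *: map_poly phi m = map_poly phi w * map_poly phi q.
  by rewrite -map_polyZ divE rmorphD /= t0 addr0 rmorphM.
have a0 : phi a != 0 by rewrite rmorphXn expf_neq0.
have w0 : map_poly phi w != 0.
  apply/eqP=> w0; move/eqP: wqE; rewrite w0 mul0r scaler_eq0 (negPf a0) /=.
  by rewrite (negPf m_neq0).
have wx : (map_poly phi w).[x] = 0.
  have /eqP := congr1 (fun p => p.[x]) wqE.
  by rewrite hornerM hornerZ m_root mulr0 eq_sym mulf_eq0 (negPf nrx) orbF => /eqP.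
(* As [x] is a root of the cofactor [w], minimality gives [w] the full size of [m], which leaves
   only a constant for [q]. *)
have le_w : (size m <= size (map_poly phi w))%N.
  by rewrite leqNgt; apply: contra w0 => /(m_min wx) ->.
have := congr1 (fun p : {poly C} => size p) wqE.
rewrite size_scale // size_mul // -m_size => sizeE.
have q1 : (size q <= 1)%N.
  have sq_gt0 : (0 < size (map_poly phi q))%N by rewrite size_poly_gt0.
  have : (size m + (size (map_poly phi q)).-1 <= size m)%N.
    rewrite [X in (_ <= X)%N]sizeE -(prednK sq_gt0) addnS /=.
    by rewrite leq_add2r.
  rewrite -[X in (_ <= X)%N]addn0 leq_add2l leqn0 qE -q_size.
  by case: (size q) => [|[]].
exists u, v, q`_0; have /size1_polyC qc := q1.
rewrite -q0E -qE; split; first by rewrite {1}qc map_polyC.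
by apply: contraNneq q_neq0 => q00; rewrite qc map_polyC /= q00 polyC0.
Qed.

(** Each pseudo-division has its own power of the leading coefficient. Raising them all to the sum
    of the exponents gives one factor that can be pulled out of linear combinations. *)
Lemma common_pseudo_division (r : nat) (b : 'I_r -> {poly A}) :
  exists K (q t : 'I_r -> {poly A}), forall j,
    lead_coef m ^+ K *: b j = q j * m + t j /\ (size (t j) < size m)%N.
Proof.
pose k j := scalp (b j) m.
pose K := (\sum_j k j)%N; pose e j := lead_coef m ^+ (K - k j).
exists K, (fun j => e j *: (b j %/ m)), (fun j => e j *: (b j %% m)) => j.
have le_k : (k j <= K)%N by rewrite /K (bigD1 j) //= leq_addr.
split.
  rewrite -[in LHS](subnK le_k) exprD -scalerA Pdiv.Idomain.divp_eq scalerDr.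
  by rewrite scalerAl.
rewrite (leq_ltn_trans (size_scale_leq _ _)) // ltn_modp.
by apply: contraNneq m_neq0 => ->; rewrite rmorph0.
Qed.

(** Over a closed field [p] has as many distinct roots as its degree, too many for [q] to vanish at
    all of them. *)
Lemma separable_nonroot (p q : {poly C}) : separable_poly p -> q != 0 ->
  (size q < size p)%N -> exists2 y, p.[y] = 0 & q.[y] != 0.
Proof.
move=> sepp q0 ltqp; apply: contrapT => noy.
have [s pE] := closed_field_poly_normal p.
have p0 : p != 0 by rewrite -size_poly_gt0 (leq_ltn_trans _ ltqp).
have lp0 : lead_coef p != 0 by rewrite lead_coef_eq0.
have us : uniq s.
  rewrite -separable_prod_XsubC; move: sepp; rewrite {1}pE.
  by rewrite (eqp_separable (eqp_scale _ lp0)).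
have roots : all (root q) s.
  apply/allP=> y ys; rewrite rootE; apply: contraPT noy => qy; apply.
  exists y => //; rewrite pE hornerZ; apply/eqP; rewrite mulf_eq0.
  by apply/orP; right; rewrite -rootE root_prod_XsubC.
have := max_poly_roots q0 roots us; move: ltqp.
rewrite pE size_scale // size_prod_XsubC ltnS => h1 h2.
by have := leq_ltn_trans h1 h2; rewrite ltnn.
Qed.

(** Modulo [m] the [b j] become remainders [t j]. A specialization is chosen under which the
    combination of the [t j] stays nonzero and [m] keeps its size and its separability; some root of
    the specialized [m] is then no root of the shorter combination and can serve as image of
    ['X]. *)
Lemma adjoin_algebraic : generic_point phi -> generic_point (horner_at phi x).
Proof.
move=> gen r c b j0 cfree bj0.
have [u [v [d [bez d0]]]] := minimal_bezout.
have [K [q [t qt]]] := common_pseudo_division b.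
set a := lead_coef m in qt; have a0 : phi a != 0 by exact: trimmed_lead.
have evt (f : {rmorphism A -> C}) y j : (map_poly f m).[y] = 0 ->
    (map_poly f (t j)).[y] = f a ^+ K * horner_at f y (b j).
  move=> my; have [tE _] := qt j; rewrite -rmorphXn -hornerZ -map_polyZ tE.
  by rewrite rmorphD rmorphM hornerD hornerM my mulr0 add0r.
have /coef_neq0[k] : map_poly phi (t j0) != 0.
  apply: contraNneq bj0 => tj0; have := evt phi x j0 m_root.
  rewrite tj0 horner0 => /esym/eqP.
  by rewrite mulf_eq0 expf_eq0 (negPf a0) andbF.
rewrite coef_map => tk0.
(* The factor [a * d] lets the one nonvanishing given by [gen] also protect the leading coefficient
   [a] and the Bezout constant [d]. *)
have : phi (a * d * (t j0)`_k) != 0 by rewrite !rmorphM !mulf_neq0.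
case/(gen r c (fun j => a * d * (t j)`_k) j0 cfree) => psi [ker].
under eq_bigr do rewrite rmorphM mulrCA.
rewrite -mulr_sumr mulf_eq0 rmorphM mulf_eq0 !negb_or => /andP[/andP[psia psid] sum0].
have Msize : size (map_poly psi m) = size m by rewrite size_map_poly_id0.
have sepM : separable_poly (map_poly psi m).
  rewrite unlock; apply/Bezout_coprimepP.
  exists ((psi d)^-1 *: map_poly psi u, (psi d)^-1 *: map_poly psi v) => /=.
  have : map_poly phi (u * m + v * m^`() - d%:P) = 0.
    by rewrite rmorphB /= bez map_polyC subrr.
  move/(map_poly_ker ker)/eqP; rewrite rmorphB /= map_polyC subr_eq0.
  rewrite rmorphD !rmorphM /= -deriv_map => /eqP E.
  by rewrite -!scalerAl -scalerDr E -mul_polyC -polyCM mulVf // eqpxx.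
pose p := \sum_j c j *: map_poly psi (t j).
have p0 : p != 0.
  apply: contra sum0 => /eqP p0; have := congr1 (fun w : {poly C} => w`_k) p0.
  rewrite coef0 coef_sum => pk0; rewrite -[X in _ == X]pk0; apply/eqP.
  by apply: eq_bigr => j _; rewrite coefZ coef_map.
have psize : (size p < size (map_poly psi m))%N.
  rewrite Msize (leq_ltn_trans (size_sum _ _ _)) //.
  have m_gt0 : (0 < size m)%N by exact: ltnW minimal_size_gt1.
  rewrite -(prednK m_gt0) ltnS; apply/bigmax_leqP=> j _.
  rewrite (leq_trans (size_scale_leq _ _)) // (leq_trans (size_poly _ _)) //.
  by have [_] := qt j; rewrite -{1}(prednK m_gt0) ltnS.
have [y my py0] := separable_nonroot sepM p0 psize.
exists (horner_at psi y); split=> [w|].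
  rewrite horner_atE => wx.
  have := Pdiv.Idomain.divp_eq w m; set l := scalp w m => wE.
  (* By minimality of [m], [phi] kills the remainder of any [w] vanishing at [x]; hence so does
     [psi]. *)
  have rem0 : map_poly phi (w %% m) = 0.
    apply: m_min.
      have -> : w %% m = lead_coef m ^+ l *: w - w %/ m * m by rewrite wE addrC addKr.
      rewrite rmorphB /= map_polyZ rmorphM hornerD hornerN hornerZ hornerM wx m_root.
      by rewrite !mulr0 subrr.
    rewrite (leq_ltn_trans (size_map_le _)) // ltn_modp.
    by apply: contraNneq m_neq0 => ->; rewrite rmorph0.
  have := congr1 (fun s => (map_poly psi s).[y]) wE.
  rewrite /= map_polyZ rmorphD /= rmorphM hornerZ hornerD hornerM my mulr0 add0r.
  rewrite (map_poly_ker ker rem0) horner0 => /eqP.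
  by rewrite rmorphXn mulf_eq0 expf_eq0 (negPf psia) andbF /= => /eqP.
apply: contra py0 => /eqP s0; rewrite /p horner_sum.
under eq_bigr do rewrite hornerZ evt // mulrCA.
by rewrite -mulr_sumr s0 mulr0.
Qed.

End Algebraic.

Lemma adjoin_generic (x : C) :
  generic_point phi -> generic_point (horner_at phi x).
Proof.
move=> gen; have [trx|] := pselect (forall p, (map_poly phi p).[x] = 0 ->
  map_poly phi p = 0); first exact: adjoin_transcendental.
move=> /existsNP[p0 /not_implyP[p0x p0_neq0]].
pose P p := (map_poly phi p).[x] = 0 /\ map_poly phi p != 0.
have Pp0 : P p0 by split=> //; apply/eqP.
have [p [px p_neq0] p_min] := ex_argmin (fun q => size (map_poly phi q)) Pp0.
have [m mE m_size] := trim_poly p.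
apply: (@adjoin_algebraic x m) => //; rewrite ?mE //.
move=> q qx ltqm; apply: contraTeq ltqm => q0; rewrite -leqNgt m_size.
by apply: p_min; split.
Qed.

End Adjoin.

(** [A] is an iterated polynomial ring over Q with one variable per entry of [s], evaluated by [phi]
    at these entries; the kernel of [phi] thus records their polynomial relations over Q. *)
Lemma generic_point_seq (s : seq C) : exists (A : idomainType)
    (iota : {rmorphism rat -> A}) (phi : {rmorphism A -> C}) (pre : C -> A),
  generic_point phi /\ {in s, cancel pre phi}.
Proof.
elim: s => [|x s [A [iota [phi [pre [gen preK]]]]]].
  exists rat, idfun, ratr, (fun=> 0); split=> //; exact: generic_point_rat.
exists {poly A}, (polyC \o iota : {rmorphism _ -> _}), (horner_at phi x).
exists (fun y => if y == x then 'X else (pre y)%:P).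
split=> [|y]; first exact: adjoin_generic.
rewrite inE; case: eqVneq => [-> _|_ /= ys]; rewrite horner_atE.
  by rewrite map_polyX hornerX.
by rewrite map_polyC hornerC; exact: preK.
Qed.

End Generic.

(** * Polynomial functions on matrices *)

Section RatCombinations.
Variable C : numClosedFieldType.

Lemma rat_free_cons (r : nat) (c : 'I_r -> C) (x : C) : rat_free c ->
  (forall q : 'I_r -> rat, x <> \sum_j c j * ratr (q j)) ->
  rat_free (fun j : 'I_r.+1 => oapp c x (unlift ord0 j)).
Proof.
move=> cfree xNspan q; rewrite big_ord_recl unlift_none /=.
under eq_bigr do rewrite liftK /=.
move=> sum0; have q00 : q ord0 = 0.
  apply: contrapT => /eqP q0; apply: (xNspan (fun j => - (q (lift ord0 j) / q ord0))).
  have rq0 : ratr (q ord0) != 0 :> C by rewrite fmorph_eq0.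
  move/eqP: sum0; rewrite addr_eq0 => /eqP sum0.
  apply: (mulIf rq0); rewrite sum0 mulr_suml -sumrN; apply: eq_bigr => j _.
  by rewrite rmorphN fmorph_div mulrN mulNr -mulrA divfK.
move: sum0; rewrite q00 rmorph0 mulr0 add0r => /cfree qS j.
by case: (unliftP ord0 j) => [i|] ->.
Qed.

Lemma rat_basis (s : seq C) : exists (r : nat) (c : 'I_r -> C), rat_free c /\
  forall a, a \in s -> exists q : 'I_r -> rat, a = \sum_j c j * ratr (q j).
Proof.
elim: s => [|x s [r [c [cfree span]]]].
  by exists 0, (fun=> 0); split=> // q _ [].
have [[q xE]|xNspan] := pselect (exists q : 'I_r -> rat, x = \sum_j c j * ratr (q j)).
  exists r, c; split=> // a; rewrite inE => /predU1P[->|/span//].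
  by exists q.
exists r.+1, (fun j => oapp c x (unlift ord0 j)); split.
  by apply: rat_free_cons => // q xE; apply: xNspan; exists q.
move=> a; rewrite inE => /predU1P[->|/span[q ->]].
  exists (fun j => if unlift ord0 j is None then 1 else 0).
  rewrite big_ord_recl unlift_none /= rmorph1 mulr1 big1 ?addr0 // => j _.
  by rewrite liftK rmorph0 mulr0.
exists (fun j => oapp q 0 (unlift ord0 j)).
rewrite big_ord_recl unlift_none /= rmorph0 mulr0 add0r.
by apply: eq_bigr => j _; rewrite liftK.
Qed.

(** The coefficients of [f] are expanded over a basis of their Q-span. *)
Lemma mpoly_rat_decomp (n : nat) (f : {mpoly C[n]}) :
  exists r (c : 'I_r -> C) (g : 'I_r -> {mpoly rat[n]}),
    rat_free c /\ f = \sum_j c j *: map_mpoly ratr (g j).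
Proof.
have [r [c [cfree span]]] := rat_basis [seq f@_m | m <- msupp f].
have /choice[q qE] : forall m, exists q : 'I_r -> rat,
    m \in msupp f -> f@_m = \sum_j c j * ratr (q j).
  move=> m; case: (boolP (m \in msupp f)) => mf; last by exists (fun=> 0).
  by have [q ->] := span _ (map_f _ mf); exists q.
exists r, c, (fun j => \sum_(m <- msupp f) q m j *: 'X_[m]); split=> //.
rewrite {1}(mpolyE f).
transitivity (\sum_(j < r) \sum_(m <- msupp f) (c j * ratr (q m j)) *: 'X_[m]
    : {mpoly C[n]}); last first.
  apply: eq_bigr => j _; rewrite [map_mpoly _ _]raddf_sum scaler_sumr /=.
  by apply: eq_bigr => m _; rewrite map_mpolyZ map_mpolyX scalerA.
rewrite exchange_big /= big_seq [RHS]big_seq; apply: eq_bigr => m mf.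
by rewrite qE // scaler_suml.
Qed.

End RatCombinations.

Section Evaluation.
Variables (d : nat).

(** Unlike [mxeval], this allows matrices over rings such as the [A] of [generic_point_seq], where
    points live before specialization. *)
Definition evalQ (B : comNzRingType) (iota : rat -> B) (M : 'M[B]_d)
    (p : {mpoly rat[d * d]}) : B :=
  mmap iota (mxvec M 0) p.

Lemma rmorph_rat (C : numFieldType) (h : {rmorphism rat -> C}) : h =1 ratr.
Proof. move=> q; rewrite -[in LHS](divq_num_den q) -[(numq q)%:~R / _]/(ratr q : rat).
exact: fmorph_rat. Qed.

Lemma rmorph_evalQ (B : comNzRingType) (C : numFieldType)
    (iota : {rmorphism rat -> B}) (h : {rmorphism B -> C}) (M : 'M[B]_d) p :
  h (evalQ iota M p) = evalQ ratr (map_mx h M) p.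
Proof.
rewrite /evalQ /mmap rmorph_sum; apply: eq_bigr => m _.
rewrite rmorphM [h (iota _)](rmorph_rat (h \o iota)) rmorph_prod.
by congr (_ * _); apply: eq_bigr => i _; rewrite rmorphXn -map_mxvec mxE.
Qed.

Lemma mxeval_map_ratr (C : numFieldType) (g : 'M[C]_d) (p : {mpoly rat[d * d]}) :
  mxeval (map_mpoly ratr p) g = evalQ ratr g p.
Proof.
rewrite /mxeval /evalQ [in LHS](mpolyE p) [map_mpoly _ _]raddf_sum [LHS]raddf_sum.
by apply: eq_bigr => m _ /=; rewrite map_mpolyZ map_mpolyX mevalZ mevalX.
Qed.

Lemma mxeval_generic (K : fieldType) (i j : 'I_d) (g : 'M[K]_d) :
  mxeval 'X_(mxvec_index i j) g = g i j.
Proof. by rewrite /mxeval mevalXU mxvecE. Qed.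

Lemma mxevalD (K : fieldType) p q (g : 'M[K]_d) :
  mxeval (p + q) g = mxeval p g + mxeval q g.
Proof. exact: mevalD. Qed.

Lemma mxevalM (K : fieldType) p q (g : 'M[K]_d) :
  mxeval (p * q) g = mxeval p g * mxeval q g.
Proof. exact: mevalM. Qed.

Lemma mxevalXn (K : fieldType) p n (g : 'M[K]_d) :
  mxeval (p ^+ n) g = mxeval p g ^+ n.
Proof. exact: (rmorphXn (meval (mxvec g 0))). Qed.

(** Induction on the construction of a polynomial. It serves for polynomial functions, for fractions
    with a power of the determinant as denominator, and for Laurent polynomials. *)
Lemma mxeval_comp (K : fieldType) (T : Type) (P : (T -> K) -> Prop)
    (M : T -> 'M[K]_d) :
  (forall c, P (fun=> c)) ->
  (forall F G, P F -> P G -> P (fun t => F t + G t)) ->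
  (forall F G, P F -> P G -> P (fun t => F t * G t)) ->
  (forall i j, P (fun t => M t i j)) ->
  forall f, P (fun t => mxeval f (M t)).
Proof.
move=> Pc Pd Pm PM f; rewrite /mxeval.
under eq_fun do rewrite mevalE.
elim: (msupp f) => [|m s IH].
  by under eq_fun do rewrite big_nil; exact: Pc.
under eq_fun do rewrite big_cons.
apply: (Pd _ _) => //; apply: (Pm _ _) => //.
elim: (index_enum _) => [|i r IHr].
  by under eq_fun do rewrite big_nil; exact: Pc.
under eq_fun do rewrite big_cons.
have {}PM : P (fun t => mxvec (M t) 0 i).
  by case/mxvec_indexP: i => i j; under eq_fun do rewrite mxvecE.
apply: (Pm _ _) => //; elim: (m i) => [|k IHk].
  by under eq_fun do rewrite expr0; exact: Pc.
by under eq_fun do rewrite exprS; exact: Pm.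
Qed.

Variable K : fieldType.

Definition generic_mx : 'M[{mpoly K[d * d]}]_d :=
  \matrix_(i, j) 'X_(mxvec_index i j).

Lemma map_generic_mx (g : 'M[K]_d) : map_mx (meval (mxvec g 0)) generic_mx = g.
Proof. by apply/matrixP=> i j; rewrite !mxE; exact: mxeval_generic. Qed.

Definition poly_fun (F : 'M[K]_d -> K) : Prop :=
  exists f, forall g, mxeval f g = F g.

Lemma poly_fun_const c : poly_fun (fun=> c).
Proof. by exists c%:MP => g; rewrite /mxeval mevalC. Qed.

Lemma poly_funD F G : poly_fun F -> poly_fun G -> poly_fun (fun g => F g + G g).
Proof.
by move=> [f fE] [h hE]; exists (f + h) => g; rewrite mxevalD fE hE.
Qed.

Lemma poly_funM F G : poly_fun F -> poly_fun G -> poly_fun (fun g => F g * G g).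
Proof.
by move=> [f fE] [h hE]; exists (f * h) => g; rewrite mxevalM fE hE.
Qed.

Lemma poly_fun_entry i j : poly_fun (fun g => g i j).
Proof. by exists 'X_(mxvec_index i j) => g; rewrite mxeval_generic. Qed.

Lemma poly_fun_sum (I : Type) (r : seq I) (F : I -> 'M[K]_d -> K) :
  (forall i, poly_fun (F i)) -> poly_fun (fun g => \sum_(i <- r) F i g).
Proof.
move=> PF; elim: r => [|i r IH].
  by under eq_fun do rewrite big_nil; exact: poly_fun_const.
by under eq_fun do rewrite big_cons; exact: poly_funD.
Qed.

Lemma mxeval_mulmxl (l : 'M[K]_d) f : exists h, forall g, mxeval h g = mxeval f (l *m g).
Proof.
apply: (@mxeval_comp K _ poly_fun (fun g => l *m g)).
- exact: poly_fun_const.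
- exact: poly_funD.
- exact: poly_funM.
move=> i j; under eq_fun do rewrite mxE.
by apply: poly_fun_sum => k; apply: poly_funM;
  [exact: poly_fun_const|exact: poly_fun_entry].
Qed.

Lemma mxeval_mulmxr (l : 'M[K]_d) f : exists h, forall g, mxeval h g = mxeval f (g *m l).
Proof.
apply: (@mxeval_comp K _ poly_fun (fun g => g *m l)).
- exact: poly_fun_const.
- exact: poly_funD.
- exact: poly_funM.
move=> i j; under eq_fun do rewrite mxE.
by apply: poly_fun_sum => k; apply: poly_funM;
  [exact: poly_fun_entry|exact: poly_fun_const].
Qed.

(** By Cramer's rule the entries of the inverse are those of the adjugate over the determinant; sums
    are brought to a common denominator. *)
Lemma mxeval_invmx f : exists h N, forall g : 'M[K]_d, g \in unitmx ->
  mxeval h g = \det g ^+ N * mxeval f (invmx g).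
Proof.
pose P F := exists h N, forall g : 'M[K]_d, g \in unitmx ->
  mxeval h g = \det g ^+ N * F g.
have det_eval g : mxeval (\det generic_mx) g = \det g.
  by rewrite /mxeval -det_map_mx map_generic_mx.
apply: (@mxeval_comp K _ P invmx).
- by move=> c; exists c%:MP, 0 => g _; rewrite mul1r /mxeval mevalC.
- move=> F G [f1 [N1 E1]] [f2 [N2 E2]].
  exists (f1 * \det generic_mx ^+ N2 + f2 * \det generic_mx ^+ N1), (N1 + N2)%N.
  move=> g gu; rewrite mxevalD !mxevalM !mxevalXn.
  rewrite !det_eval E1 // E2 // exprD mulrDr -!mulrA; congr (_ + _).
    by rewrite [F g * _]mulrC.
  by rewrite [G g * _]mulrC mulrCA.
- move=> F G [f1 [N1 E1]] [f2 [N2 E2]]; exists (f1 * f2), (N1 + N2)%N => g gu.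
  by rewrite mxevalM E1 // E2 // exprD mulrACA.
move=> i j; exists ((\adj generic_mx) i j), 1 => g gu.
rewrite /invmx gu !mxE expr1 mulrA divff ?mul1r; last by rewrite -unitfE.
have := congr1 (fun M : 'M[K]_d => M i j) (map_mx_adj (meval (mxvec g 0)) generic_mx).
by rewrite map_generic_mx !mxE.
Qed.

End Evaluation.

(** * Laurent polynomial functions *)

Section Laurent.
Variable C : numClosedFieldType.

Definition laurent (F : C -> C) : Prop :=
  exists (M : nat) (u : {poly C}), forall z, z != 0 -> z ^+ M * F z = u.[z].

Lemma laurent_const c : laurent (fun=> c).
Proof. by exists 0, c%:P => z _; rewrite mul1r hornerC. Qed.

Lemma laurentD F G : laurent F -> laurent G -> laurent (fun z => F z + G z).
Proof.
move=> [M [u uE]] [N [v vE]]; exists (M + N)%N, ('X^N * u + 'X^M * v) => z z0.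
rewrite hornerD !hornerM !hornerXn -uE // -vE // exprD mulrDr !mulrA.
by rewrite [z ^+ N * _]mulrC.
Qed.

Lemma laurentM F G : laurent F -> laurent G -> laurent (fun z => F z * G z).
Proof.
move=> [M [u uE]] [N [v vE]]; exists (M + N)%N, (u * v) => z z0.
by rewrite hornerM -uE // -vE // exprD mulrACA.
Qed.

Lemma laurentX (k : int) : laurent (fun z => z ^ k).
Proof.
case: k => k; first by exists 0, 'X^k => z _; rewrite mul1r hornerXn.
by exists k.+1, 1 => z z0; rewrite hornerC NegzE -exprnN divff // expf_neq0.
Qed.

Lemma laurent_sum (I : Type) (r : seq I) (F : I -> C -> C) :
  (forall i, laurent (F i)) -> laurent (fun z => \sum_(i <- r) F i z).
Proof.
move=> LF; elim: r => [|i r IH].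
  by under eq_fun do rewrite big_nil; exact: laurent_const.
by under eq_fun do rewrite big_cons; exact: laurentD.
Qed.

Lemma poly_rat_zero (u : {poly C}) :
  (forall q : rat, q != 0 -> u.[ratr q] = 0) -> u = 0.
Proof.
move=> u0; apply/eqP; apply: contraT => un0.
suff: (size u < size u)%N by rewrite ltnn.
(* The test points start at 1, since vanishing is only assumed at nonzero rationals. *)
have := @max_poly_roots _ u [seq (ratr i.+1%:R) | i <- iota 0 (size u)] un0.
rewrite size_map size_iota; apply.
  by apply/allP=> y /mapP[i _ ->]; apply/eqP/u0; rewrite pnatr_eq0.
rewrite map_inj_uniq ?iota_uniq // => i j /fmorph_inj/eqP.
by rewrite eqr_nat => /eqP[].
Qed.

(** The multiplicative group is irreducible and its rational points are dense: with denominators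
    cleared, C[z] has no zero divisors. *)
Lemma laurent_domain F G : laurent F -> laurent G ->
  (forall q : rat, q != 0 -> F (ratr q) * G (ratr q) = 0) ->
  (forall z, z != 0 -> F z = 0) \/ (forall z, z != 0 -> G z = 0).
Proof.
move=> [M [u uE]] [N [v vE]] FG0.
have /eqP : u * v = 0.
  apply: poly_rat_zero => q q0; have rq0 : ratr q != 0 :> C by rewrite fmorph_eq0.
  by rewrite hornerM -uE // -vE // mulrACA FG0 // mulr0.
have kill (H : C -> C) K (w : {poly C}) : (forall z, z != 0 -> z ^+ K * H z = w.[z]) ->
    w = 0 -> forall z, z != 0 -> H z = 0.
  move=> wE w0 z z0; have /eqP := wE z z0.
  by rewrite w0 horner0 mulf_eq0 expf_eq0 (negPf z0) andbF => /eqP.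
rewrite mulf_eq0 => /orP[] /eqP.
  by move/(kill _ _ _ uE); left.
by move/(kill _ _ _ vE); right.
Qed.

End Laurent.

(** * The group generated by the cocharacters of a rational group *)

Section Words.
Variables (d s : nat) (a : 'I_s -> int).

(* The value at q of the cocharacter z |-> \sum_k z ^ (a k) x k; h embeds Q into B. *)
Definition lam (B : comNzRingType) (h : rat -> B) (x : {ffun 'I_s -> 'M[B]_d})
    (q : rat) : 'M[B]_d :=
  \sum_k h (q ^ a k) *: x k.

(** The parameters are rational, so a word is a polynomial expression over Q in the entries of its
    points and specializes along with them. *)
Definition word (B : comNzRingType) (h : rat -> B)
    (w : seq ({ffun 'I_s -> 'M[B]_d} * rat)) : 'M[B]_d :=
  foldr (fun p g => lam h p.1 p.2 *m g) 1%:M w.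

Definition map_pt (B B' : comNzRingType) (h : B -> B')
    (x : {ffun 'I_s -> 'M[B]_d}) : {ffun 'I_s -> 'M[B']_d} :=
  [ffun k => map_mx h (x k)].

Lemma map_lam (B : comNzRingType) (C : numFieldType) (iota : {rmorphism rat -> B})
    (h : {rmorphism B -> C}) x q :
  map_mx h (lam iota x q) = lam ratr (map_pt h x) q.
Proof.
rewrite /lam raddf_sum; apply: eq_bigr => k _ /=.
by rewrite map_mxZ ffunE [h _](rmorph_rat (h \o iota)).
Qed.

Lemma map_word (B : comNzRingType) (C : numFieldType) (iota : {rmorphism rat -> B})
    (h : {rmorphism B -> C}) w :
  map_mx h (word iota w) = word ratr [seq (map_pt h p.1, p.2) | p <- w].
Proof. by elim: w => [|p w IH] /=; rewrite ?map_mx1 // map_mxM map_lam IH. Qed.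

Lemma word_cat (B : comNzRingType) (h : rat -> B) w1 w2 :
  word h (w1 ++ w2) = word h w1 *m word h w2.
Proof. by elim: w1 => [|p w IH] /=; rewrite ?mul1mx // IH mulmxA. Qed.

End Words.

Section Hull.
Variables (R : realType) (d s : nat) (a : 'I_s -> int).
Local Notation C := R[i].
Variable G : set 'M[C]_d.
Hypothesis algG : algebraic_subgroupQ G.
Local Notation lam := (lam a).
Local Notation word := (word a).
Local Notation pt := ({ffun 'I_s -> 'M[C]_d}).

(** The properties of a cocharacter of [G] are stated at rational parameters, as polynomial
    conditions over Q on the entries of [x], so that they pass to specializations. *)
Definition cochar (x : pt) : Prop :=
  lam ratr x 1 = 1%:M /\
  forall q, q != 0 -> lam ratr x q *m lam ratr x q^-1 = 1%:M /\ G (lam ratr x q).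

Definition cochar_word (w : seq (pt * rat)) : Prop :=
  forall p, p \in w -> cochar p.1 /\ p.2 != 0.

Definition cochar_group : set 'M[C]_d := [set word ratr w | w in cochar_word].

(** [psi] respects every relation over Q that holds under [phi]. Invertibility also comes from such
    a relation, the one between the values at [q] and [q^-1]. *)
Lemma cochar_specialize (A : idomainType) (iota : {rmorphism rat -> A})
    (phi psi : {rmorphism A -> C}) x :
  (forall b, phi b = 0 -> psi b = 0) ->
  cochar (map_pt phi x) -> cochar (map_pt psi x).
Proof.
move=> ker; have transfer (M N : 'M[A]_d) :
    map_mx phi M = map_mx phi N -> map_mx psi M = map_mx psi N.
  move=> MN; apply/matrixP=> i j; rewrite !mxE; apply/eqP.
  rewrite -subr_eq0 -rmorphB; apply/eqP/ker; rewrite rmorphB.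
  by have /matrixP/(_ i j) := MN; rewrite !mxE => ->; rewrite subrr.
case=> x1 xq; split.
  by rewrite -(map_lam a iota) -(map_mx1 psi); apply: transfer; rewrite map_lam map_mx1.
move=> q q0; have [xV xG] := xq q q0.
have psiV : lam ratr (map_pt psi x) q *m lam ratr (map_pt psi x) q^-1 = 1%:M.
  rewrite -!(map_lam a iota) -map_mxM -(map_mx1 psi); apply: transfer.
  by rewrite map_mxM !map_lam map_mx1.
split; first exact: psiV.
case: algG => _ _ _ [S GE]; rewrite GE; split.
  exact: (proj1 (mulmx1_unit psiV)).
move=> p Sp; rewrite mxeval_map_ratr -(map_lam a iota) -(rmorph_evalQ iota).
apply: ker; rewrite (rmorph_evalQ iota) map_lam -mxeval_map_ratr.
by move: xG; rewrite GE => -[_]; apply.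
Qed.

Lemma cochar_group1 : cochar_group 1%:M.
Proof. by exists [::]. Qed.

Lemma cochar_groupM g h : cochar_group g -> cochar_group h -> cochar_group (g *m h).
Proof.
move=> [w1 w1P <-] [w2 w2P <-]; exists (w1 ++ w2); last exact: word_cat.
by move=> p; rewrite mem_cat => /orP[/w1P|/w2P].
Qed.

Lemma cochar_group_lam x q : cochar x -> q != 0 -> cochar_group (lam ratr x q).
Proof.
move=> cx q0; exists [:: (x, q)]; last by rewrite /= mulmx1.
by move=> p; rewrite inE => /eqP ->.
Qed.

Lemma cochar_group_ind (P : 'M[C]_d -> Prop) : P 1%:M ->
  (forall x q g, cochar x -> q != 0 -> cochar_group g -> P g ->
     P (lam ratr x q *m g)) ->
  cochar_group `<=` P.
Proof.
move=> P1 PS _ [w wP <-]; elim: w wP => // [[x q] w IH] wP /=.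
have [cx q0] := wP (x, q) (mem_head _ _).
have wP' : cochar_word w by move=> p pw; apply: wP; rewrite inE pw orbT.
by apply: PS => //; [exists w|exact: IH].
Qed.

Lemma cochar_group_unit g : cochar_group g -> g \in unitmx.
Proof.
move: g; apply: cochar_group_ind => [|x q g [_ cx] /cx[xV _] _ gu].
  exact: unitmx1.
by rewrite unitmx_mul gu andbT; case: (mulmx1_unit xV).
Qed.

Lemma cochar_groupV g : cochar_group g -> cochar_group (invmx g).
Proof.
move: g; apply: cochar_group_ind => [|x q g cx q0 gL IH].
  by rewrite invmx1; exact: cochar_group1.
have [xV _] := cx.2 q q0; have [ux _] := mulmx1_unit xV.
have -> : invmx (lam ratr x q *m g) = invmx g *m lam ratr x q^-1.
  have gu := cochar_group_unit gL.
  have lg : lam ratr x q *m g \in unitmx by rewrite unitmx_mul ux.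
  apply: (can_inj (mulKmx lg)); rewrite mulmxV // !mulmxA.
  by rewrite -[_ *m g *m _]mulmxA mulmxV // mulmx1 xV.
by apply: cochar_groupM => //; apply: cochar_group_lam; rewrite ?invr_eq0.
Qed.

Lemma cochar_group_sub : cochar_group `<=` G.
Proof.
have [G1 GM _ _] := algG; apply: cochar_group_ind => // x q g cx q0 _ Gg.
by apply: GM => //; have [] := cx.2 q q0.
Qed.

(** * The closure of the generated group, and its rationality *)

Definition vanishes (f : {mpoly C[d * d]}) : Prop :=
  forall l, cochar_group l -> mxeval f l = 0.

(* A word in cocharacters at which g j is not zero specializes, over Q, to another
   such word at which f itself is not zero. *)
Lemma vanishes_rat (r : nat) (c : 'I_r -> C) (g : 'I_r -> {mpoly rat[d * d]}) :
  rat_free c -> vanishes (\sum_j c j *: map_mpoly ratr (g j)) ->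
  forall j, vanishes (map_mpoly ratr (g j)).
Proof.
move=> cfree fL j0 _ [w wP <-]; apply: contrapT => /eqP gj0.
(* All entries of all letters are lifted to one ring [A], so that a single specialization moves the
   whole word. *)
pose entries := [seq (p : pt * rat).1 t.1.1 t.1.2 t.2 |
    p <- w, t <- enum {: 'I_s * 'I_d * 'I_d}].
have [A [iota [phi [pre [gen preK]]]]] := generic_point_seq entries.
have phiK p : p \in w -> map_pt phi (map_pt pre p.1) = p.1.
  move=> pw; apply/ffunP=> k; rewrite !ffunE; apply/matrixP=> i j; rewrite !mxE.
  apply: preK; apply/allpairsP; exists (p, ((k, i), j)); split=> //=.
  by rewrite mem_enum.
pose W := [seq (map_pt pre p.1, p.2) | p <- w].
have phiW : map_mx phi (word iota W) = word ratr w.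
  rewrite map_word -map_comp; congr word.
  rewrite -[RHS]map_id; apply/eq_in_map => p pw /=.
  by rewrite phiK //; case: (p).
have : phi (evalQ iota (word iota W) (g j0)) != 0.
  by rewrite (rmorph_evalQ iota) phiW -mxeval_map_ratr.
case/(gen r c (fun j => evalQ iota (word iota W) (g j)) j0 cfree) => psi [ker].
case/eqP; under eq_bigr do rewrite (rmorph_evalQ iota) -mxeval_map_ratr.
have /fL : cochar_group (map_mx psi (word iota W)).
  rewrite map_word; exists [seq (map_pt psi p.1, p.2) | p <- W] => //.
  move=> _ /mapP[_ /mapP[p pw ->] ->] /=; have [cp p0] := wP p pw; split=> //.
  by apply: (cochar_specialize iota ker); rewrite phiK.
rewrite /mxeval [LHS]raddf_sum => s0; rewrite -[RHS]s0; apply: eq_bigr => j _.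
by rewrite [RHS]mevalZ.
Qed.

(** The Zariski closure of [cochar_group] in GL_d(C), cut out at first by complex equations. *)
Definition cochar_hull : set 'M[C]_d :=
  [set g | g \in unitmx /\ forall f, vanishes f -> mxeval f g = 0].

Lemma hull_cochar_group : cochar_group `<=` cochar_hull.
Proof. by move=> l lL; split=> [|f]; [exact: cochar_group_unit|exact]. Qed.

(** The rational components of a vanishing polynomial vanish too, by [vanishes_rat], so the rational
    equations imply the complex ones. *)
Lemma hull_rat : cochar_hull = [set g | g \in unitmx /\
  forall p, vanishes (map_mpoly ratr p) -> mxeval (map_mpoly ratr p) g = 0].
Proof.
apply/seteqP; split=> g [gu gP]; split=> //; first by move=> p; exact: gP.
move=> f.
have [r [c [h [cfree ->]]]] := mpoly_rat_decomp f.
move=> /(vanishes_rat cfree) van.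
rewrite /mxeval [LHS]raddf_sum big1 // => j _.
by rewrite [LHS]mevalZ [_.@[_]](gP (h j)) ?mulr0 //; exact: van.
Qed.

(** First half of the usual argument that the closure of a group is a group; [hullM] then fixes the
    right factor in the closure and lets the left one vary. *)
Lemma hull_mull l g : cochar_group l -> cochar_hull g -> cochar_hull (l *m g).
Proof.
move=> lL [gu gP]; split; first by rewrite unitmx_mul gu cochar_group_unit.
move=> f fL; have [h hE] := mxeval_mulmxl l f; rewrite -hE; apply: gP => l' l'L.
by rewrite hE; apply: fL; exact: cochar_groupM.
Qed.

Lemma hullM g h : cochar_hull g -> cochar_hull h -> cochar_hull (g *m h).
Proof.
move=> gH [hu hP]; have [gu gP] := gH.
split; first by rewrite unitmx_mul gu.
move=> f fL; have [f' f'E] := mxeval_mulmxr h f; rewrite -f'E; apply: gP => l lL.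
rewrite f'E; have [_] := hull_mull lL (conj hu hP); exact.
Qed.

Lemma hullV g : cochar_hull g -> cochar_hull (invmx g).
Proof.
move=> [gu gP]; split; first by rewrite unitmx_inv.
move=> f fL; have [h [N hE]] := mxeval_invmx f.
have /eqP : mxeval h g = 0.
  apply: gP => l lL; rewrite hE ?cochar_group_unit // fL ?mulr0 //.
  exact: cochar_groupV.
rewrite hE // mulf_eq0 expf_eq0 => /orP[/andP[_ /eqP dg0]|/eqP//].
by move: gu; rewrite unitmxE dg0 unitr0.
Qed.

Lemma hull_algebraic : algebraic_subgroupQ cochar_hull.
Proof.
split; [exact/hull_cochar_group/cochar_group1|exact: hullM|exact: hullV|].
by exists [set p | vanishes (map_mpoly ratr p)]; exact: hull_rat.
Qed.

Lemma hull_sub : cochar_hull `<=` G.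
Proof.
have [_ _ _ [S GE]] := algG; move=> g [gu gP]; rewrite GE; split=> // p Sp.
by apply: gP => l /cochar_group_sub; rewrite GE => -[_]; exact.
Qed.

(** * Curves in the closure, and its connectedness *)

Definition lamC (x : pt) (z : C) : 'M[C]_d := \sum_k z ^ a k *: x k.

Lemma lamC_ratr x q : lamC x (ratr q) = lam ratr x q.
Proof. by apply: eq_bigr => k _; rewrite fmorphXz. Qed.

Lemma laurent_lamC f x g : laurent (fun z => mxeval f (lamC x z *m g)).
Proof.
apply: (@mxeval_comp d C C (@laurent C)) => //.
- exact: laurent_const.
- exact: laurentD.
- exact: laurentM.
move=> i j; under eq_fun do rewrite mxE.
apply: laurent_sum => l; apply: laurentM; last exact: laurent_const.
under eq_fun do rewrite summxE.
apply: laurent_sum => k; under eq_fun do rewrite mxE.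
by apply: laurentM; [exact: laurentX|exact: laurent_const].
Qed.

Lemma hull_lamC x z : (forall z, z != 0 -> lamC x z \in unitmx) -> cochar x ->
  z != 0 -> cochar_hull (lamC x z).
Proof.
move=> xu cx z0; split=> [|f fL]; first exact: xu.
(* With second factor 1, [laurent_domain] extends vanishing from nonzero rational to nonzero complex
   parameters. *)
have := laurent_domain (laurent_lamC f x 1%:M) (laurent_const 1).
case=> [q q0|/(_ z z0)|/(_ z z0)/eqP]; last by rewrite oner_eq0.
  rewrite mulmx1 lamC_ratr fL ?mul0r //; exact: cochar_group_lam.
by rewrite mulmx1.
Qed.

Lemma open_zariskiP (U : set (zariski C d)) : open U ->
  exists S : set {mpoly C[d * d]}, U = [set g | exists2 p, S p & mxeval p g != 0].
Proof. by []. Qed.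

Lemma hull_connected : connected (cochar_hull : set (zariski C d)).
Proof.
(* A relatively open set containing g meets the irreducible curve
   q |-> lam x q *m g in all but finitely many points. *)
have stable (U W : set (zariski C d)) : open U -> open W ->
    (forall g, cochar_hull g -> U g -> W g -> False) -> (forall g, cochar_hull g -> U g \/ W g) ->
    U 1%:M -> forall g, cochar_hull g -> U g.
  move=> /open_zariskiP[S UE] /open_zariskiP[T WE] disj cover U1.
  (* Induction on the word: the curve leads from [g], at parameter 1, to the longer word, at
     parameter [q]. Were the latter in [W], the curve would meet [U] and [W] at a common
     parameter. *)
  have UL : cochar_group `<=` U.
    apply: cochar_group_ind => // x q g cx q0 gL Ug.
    have lH : cochar_hull (lam ratr x q *m g).
      by apply: hull_mull; [exact: cochar_group_lam|exact: hull_cochar_group].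
    case: (cover _ lH) => // Wl; exfalso.
    move: Ug Wl; rewrite UE WE => -[p Sp pg] [p' Tp' p'l].
    have := laurent_domain (laurent_lamC p x g) (laurent_lamC p' x g).
    case=> [q' q'0|/(_ (ratr 1))|/(_ (ratr q))].
    - apply/eqP/negPn/negP; rewrite mulf_eq0 negb_or lamC_ratr => /andP[Up Wp].
      apply: (disj (lam ratr x q' *m g)).
      + by apply: hull_mull; [exact: cochar_group_lam|exact: hull_cochar_group].
      + by rewrite UE; exists p.
      + by rewrite WE; exists p'.
    - rewrite fmorph_eq0 oner_eq0.
      by move=> /(_ isT)/eqP; rewrite lamC_ratr cx.1 mul1mx (negPf pg).
    - rewrite lamC_ratr fmorph_eq0 => /(_ q0)/eqP; exact/negP.
  (* By density, if [W] meets the closure it meets the group itself, which lies in [U]. *)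
  move=> g [gu gP]; case: (cover g (conj gu gP)) => //.
  rewrite WE => -[p' Tp' /eqP[]]; apply: gP => l lL.
  apply/eqP/negPn/negP => p'l; apply: (disj l); first exact: hull_cochar_group.
    exact: UL.
  by rewrite WE; exists p'.
move=> B [b Bb] [U openU BU] [F closedF BF].
have openFc : open (~` F) by rewrite openC.
have H1 : cochar_hull 1%:M by have [] := hull_algebraic.
have UF g : cochar_hull g -> U g <-> F g.
  move=> Hg; split=> [Ug|Fg].
    have : B g by rewrite BU.
    by rewrite BF => -[].
  have : B g by rewrite BF.
  by rewrite BU => -[].
(* [stable] is applied to [U] and the complement of [F], the one containing 1 coming first. *)
have [U1|NU1] := pselect (U 1%:M).
  rewrite BU; apply/seteqP; split=> [g []//|g Hg]; split=> //.
  apply: (stable U (~` F)) => // h Hh; first by move/(UF _ Hh).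
  by have [/(UF _ Hh)|] := pselect (F h); [left|right].
have : B b by [].
rewrite BU => -[Hb Ub]; exfalso.
suff : (~` F) b by apply; apply/(UF _ Hb).
apply: (stable (~` F) U) => //.
- by move=> h Hh Fh /(UF _ Hh).
- by move=> h Hh; have [/(UF _ Hh)|] := pselect (F h); [right|left].
- by move/(UF _ H1).
Qed.

End Hull.

(** * Adjoining homotheties to a rational group of isometries *)

Lemma map_even_poly (A B : nzRingType) (h : {rmorphism A -> B}) (p : {poly A}) :
  map_poly h (even_poly p) = even_poly (map_poly h p).
Proof. by apply/polyP=> i; rewrite !(coef_map, coef_even_poly). Qed.

Lemma map_odd_poly (A B : nzRingType) (h : {rmorphism A -> B}) (p : {poly A}) :
  map_poly h (odd_poly p) = odd_poly (map_poly h p).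
Proof. by apply/polyP=> i; rewrite !(coef_map, coef_odd_poly). Qed.

(* The p' such that p'(X^2) = p(X) p(-X). *)
Definition even_norm (A : comNzRingType) (p : {poly A}) : {poly A} :=
  even_poly p ^+ 2 - 'X * odd_poly p ^+ 2.

Lemma horner_even_norm (A : comNzRingType) (p : {poly A}) (x : A) :
  (even_norm p).[x ^+ 2] = p.[x] * p.[- x].
Proof.
have pE y : p.[y] = (even_poly p).[y ^+ 2] + (odd_poly p).[y ^+ 2] * y.
  by rewrite -{1}(poly_even_odd p) hornerD hornerMX !horner_comp !hornerXn.
rewrite !pE sqrrN mulrN [RHS]mulrC -subr_sqr /even_norm.
by rewrite hornerD hornerN horner_exp hornerM hornerX horner_exp exprMn [x ^+ 2 * _]mulrC.
Qed.

Lemma map_even_norm (A B : comNzRingType) (h : {rmorphism A -> B}) (p : {poly A}) :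
  map_poly h (even_norm p) = even_norm (map_poly h p).
Proof.
rewrite /even_norm rmorphB /= rmorphXn /= [map_poly h (_ * _)]rmorphM /= rmorphXn /= map_polyX.
by rewrite map_even_poly map_odd_poly.
Qed.

Section Homotheties.
Variables (R : realType) (d : nat).
Local Notation C := R[i].
Local Notation P := {mpoly rat[d * d]}.

Definition rat_eval (g : 'M[C]_d) : {rmorphism P -> C} := mmap ratr (mxvec g 0).

Lemma evE g p : mxeval (map_mpoly ratr p) g = rat_eval g p.
Proof. exact: mxeval_map_ratr. Qed.

Lemma ev_generic g : map_mx (rat_eval g) (generic_mx d rat) = g.
Proof.
by apply/matrixP=> i j; rewrite !mxE /= mmapX mmap1U mxvecE.
Qed.

Lemma ev_const g (q : 'M[rat]_d) : map_mx (rat_eval g) (map_mx (@mpolyC _ _) q) = map_mx ratr q.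
Proof. by apply/matrixP=> i j; rewrite !mxE /= mmapC. Qed.

Variable q : 'M[rat]_d.
Local Notation qC := (map_mx ratr q : 'M[C]_d).

Definition isoQ : set 'M[C]_d := [set g | g \in unitmx /\ g^T *m qC *m g = qC].

Definition generic_form : 'M[P]_d :=
  (generic_mx d rat)^T *m map_mx (@mpolyC _ _) q *m generic_mx d rat.

Lemma ev_generic_form g : map_mx (rat_eval g) generic_form = g^T *m qC *m g.
Proof. by rewrite !map_mxM -map_trmx ev_generic ev_const. Qed.

Lemma ev_form g i j : rat_eval g (generic_form i j) = (g^T *m qC *m g) i j.
Proof. by rewrite -ev_generic_form [RHS]mxE. Qed.

Lemma isoQ_algebraic : algebraic_subgroupQ isoQ.
Proof.
split.
- by split; [exact: unitmx1|rewrite trmx1 mul1mx mulmx1].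
- move=> g h [gu gq] [hu hq]; split; first by rewrite unitmx_mul gu.
  by rewrite trmx_mul -[RHS]hq -[in RHS]gq !mulmxA.
- move=> g [gu gq]; split; first by rewrite unitmx_inv.
  by rewrite -[in LHS]gq !mulmxA -trmx_mul mulmxV // trmx1 mul1mx mulmxK.
exists [set p | exists i j, p = generic_form i j - (q i j)%:MP].
have entry g i j : mxeval (map_mpoly ratr (generic_form i j - (q i j)%:MP)) g =
    (g^T *m qC *m g) i j - qC i j.
  by rewrite evE rmorphB ev_form [rat_eval g _%:MP]mmapC [qC i j]mxE.
apply/seteqP; split=> g [gu gq]; split=> //.
  by move=> _ [i [j ->]]; rewrite entry gq subrr.
apply/matrixP=> i j; apply/eqP; rewrite -subr_eq0 -entry; apply/eqP/gq.
by exists i, j.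
Qed.

Section Multiplier.
Variables (i0 j0 : 'I_d).
Hypothesis q0 : q i0 j0 != 0.

(** On similitudes this is the multiplier, read off at one nonzero entry of the Gram matrix. *)
Definition chi_poly : P := ((q i0 j0)^-1)%:MP * generic_form i0 j0.

Definition chi (g : 'M[C]_d) : C := (g^T *m qC *m g) i0 j0 / ratr (q i0 j0).

Lemma ev_chi g : rat_eval g chi_poly = chi g.
Proof.
by rewrite /chi_poly rmorphM ev_form [rat_eval g _%:MP]mmapC /= fmorphV mulrC.
Qed.

Lemma chi_scale (t : C) g : isoQ g -> chi (t *: g) = t ^+ 2.
Proof.
move=> [_ gq]; rewrite /chi [(t *: g)^T]linearZ /= -!scalemxAl -scalemxAr gq scalerA mxE.
by rewrite [qC i0 j0]mxE -expr2 mulfK // fmorph_eq0.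
Qed.

(* Since f(s h) f(- s h) is even in s, it is a polynomial in h and s ^ 2. *)
Lemma even_product (f : P) : exists F : P, forall h (s : C), s ^+ 2 * chi h = 1 ->
  (rat_eval h F = 0 <-> rat_eval (s *: h) f * rat_eval (- s *: h) f = 0).
Proof.
(* [E] is [f] at the generic matrix scaled by a new variable; at [h] and [t] it takes the value of
   [f] at [t *: h]. *)
pose E : {poly P} := evalQ (polyC \o @mpolyC _ _) ('X *: map_mx polyC (generic_mx d rat)) f.
pose u := even_norm E; pose N := size u.
(* As [s ^+ 2] is the inverse of [chi h], multiplying [u] at [s ^+ 2] by [chi h ^+ N] leaves a
   polynomial in [h] alone. *)
exists (\sum_(i < N) u`_i * chi_poly ^+ (N - i)) => h s sh.
have s0 : s != 0.
  apply/eqP => s0; move/eqP: sh.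
  by rewrite s0 expr0n mul0r eq_sym oner_eq0.
have Ex (t : C) : (map_poly (rat_eval h) E).[t] = rat_eval (t *: h) f.
  pose ht : {rmorphism {poly P} -> C} := horner_morph (fun a => mulrC t (rat_eval h a)).
  have <- : ht E = (map_poly (rat_eval h) E).[t] by [].
  rewrite /E rmorph_evalQ /rat_eval /=; congr evalQ.
  apply/matrixP=> i j; rewrite !mxE /ht /= /horner_morph rmorphM /=.
  rewrite map_polyX map_polyC hornerM hornerX hornerC.
  by congr (t * _); have /matrixP/(_ i j) := ev_generic h; rewrite !mxE.
have c0 : chi h != 0.
  apply/eqP => c0; move/eqP: sh.
  by rewrite c0 mulr0 eq_sym oner_eq0.
have -> : rat_eval h (\sum_(i < N) u`_i * chi_poly ^+ (N - i)) =
    chi h ^+ N * (map_poly (rat_eval h) u).[s ^+ 2].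
  rewrite rmorph_sum (@horner_coef_wide _ N) ?size_poly // mulr_sumr.
  apply: eq_bigr => i _; rewrite rmorphM rmorphXn ev_chi coef_map /= mulrCA.
  congr (_ * _); have le_i := ltnW (ltn_ord i).
  transitivity (chi h ^+ (N - i) * (chi h ^+ i * (s ^+ 2) ^+ i)).
    by rewrite -exprMn [chi h * _]mulrC sh expr1n mulr1.
  by rewrite mulrA -exprD subnK.
rewrite map_even_norm horner_even_norm !Ex; split=> [/eqP|->]; last by rewrite mulr0.
by rewrite mulf_eq0 expf_eq0 (negPf c0) andbF => /eqP.
Qed.

End Multiplier.

(** The equations say that [g] is a similitude and that the polynomials [F f] vanish, for [f] in the
    rational ideal of [D]. Given these, [g] is scaled by a square root [s] of the inverse
    multiplier, and one of [s *: g] and [- s *: g] must lie in [D]. *)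
Lemma homothety_algebraic (D : set 'M[C]_d) : q != 0 ->
  algebraic_subgroupQ D -> D `<=` isoQ -> algebraic_subgroupQ (mulset Gm_Id D).
Proof.
move=> qn0 [D1 DM DV [S DE]] Diso.
have /existsP[i0 /existsP[j0 q0]] : [exists i, exists j, q i j != 0].
  apply: contraNT qn0 => /existsPn no; apply/eqP/matrixP=> i j.
  by have /existsPn/(_ j)/negPn/eqP -> := no i; rewrite mxE.
split.
- exists 1%:M; first by exists 1 => //=; exact: oner_neq0.
  by exists 1%:M => //; rewrite mulmx1.
- move=> _ _ [_ [t /= t0 <-] [g Dg <-]] [_ [t' /= t'0 <-] [g' Dg' <-]].
  exists ((t * t')%:M); first by exists (t * t') => //=; rewrite mulf_neq0.
  exists (g *m g'); first exact: DM.
  by rewrite !mul_scalar_mx -scalemxAl -scalemxAr scalerA.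
- move=> _ [_ [t /= t0 <-] [g Dg <-]]; exists (t^-1%:M).
    by exists t^-1 => //=; rewrite invr_eq0.
  exists (invmx g); first exact: DV.
  by rewrite !mul_scalar_mx invmxZ // unitmxZ ?unitfE //; case: (Diso g Dg).
pose I := [set p : P | forall g, D g -> rat_eval g p = 0].
have DI g : g \in unitmx -> (forall p, I p -> rat_eval g p = 0) -> D g.
  move=> gu gI; rewrite DE; split=> // p Sp; rewrite evE; apply: gI => h.
  by rewrite DE => -[_ /(_ _ Sp)]; rewrite evE.
have [F FP] := choice (even_product i0 j0).
pose lin i j := (q i0 j0)%:MP * generic_form i j - generic_form i0 j0 * (q i j)%:MP.
have ev_lin g i j : rat_eval g (lin i j) =
    ratr (q i0 j0) * ((g^T *m qC *m g) i j - chi i0 j0 g * qC i j).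
  rewrite /lin rmorphB !rmorphM !ev_form ![rat_eval g _%:MP]mmapC [qC i j]mxE mulrBr.
  congr (_ - _); rewrite /chi [RHS]mulrA; congr (_ * _).
  by rewrite mulrCA divff ?mulr1 // fmorph_eq0.
exists [set p | (exists i j, p = lin i j) \/ exists2 f, I f & p = F f].
apply/seteqP; split=> g.
  move=> [_ [t /= t0 <-] [h Dh <-]]; have [hu hq] := Diso h Dh.
  have chiE := chi_scale q0 t (Diso h Dh).
  rewrite mul_scalar_mx; split; first by rewrite unitmxZ ?unitfE.
  move=> _ [[i [j ->]]|[f If ->]]; rewrite evE.
    rewrite ev_lin chiE [(t *: h)^T]linearZ /= -!scalemxAl -scalemxAr hq scalerA mxE.
    by rewrite -expr2 subrr mulr0.
  (* The multiplier of [t *: h] is [t ^+ 2], and scaling back by [t^-1] gives [h], where [f]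
     vanishes. *)
  apply/(FP f _ t^-1); first by rewrite chiE exprVn mulVf // expf_neq0.
  by rewrite scalerA mulVf // scale1r If // mul0r.
move=> [gu gP].
have gq : g^T *m qC *m g = chi i0 j0 g *: qC.
  apply/matrixP=> i j; rewrite [in RHS]mxE; apply/eqP; rewrite -subr_eq0.
  have /eqP := gP (lin i j) (or_introl (ex_intro _ i (ex_intro _ j erefl))).
  by rewrite evE ev_lin mulf_eq0 fmorph_eq0 (negPf q0).
have c0 : chi i0 j0 g != 0.
  apply: contraNneq q0 => c0; move: gq; rewrite c0 scale0r => gq.
  have : qC = 0.
    have gtu : g^T \in unitmx by rewrite unitmx_tr.
    transitivity (invmx g^T *m (g^T *m qC *m g) *m invmx g).
      by rewrite !mulmxA mulVmx // mul1mx mulmxK.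
    by rewrite gq mulmx0 mul0mx.
  by move/matrixP/(_ i0 j0)/eqP; rewrite !mxE fmorph_eq0.
pose s := sqrtC (chi i0 j0 g)^-1.
have s2 : s ^+ 2 * chi i0 j0 g = 1 by rewrite sqrtCK mulVf.
have s0 : s != 0 by rewrite sqrtC_eq0 invr_eq0.
have nz f : I f -> rat_eval (s *: g) f * rat_eval (- s *: g) f = 0.
  by move=> If; apply/(FP f _ s s2); rewrite -evE; apply: gP; right; exists f.
have fin (t : C) : t != 0 -> D (t *: g) -> mulset Gm_Id D g.
  move=> t0 Dt; exists (t^-1%:M); first by exists t^-1 => //=; rewrite invr_eq0.
  by exists (t *: g) => //; rewrite mul_scalar_mx scalerA mulVf // scale1r.
have [|/existsNP[f1 /not_implyP[If1 /eqP f1s]]] :=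
  pselect (forall p, I p -> rat_eval (s *: g) p = 0).
  by move/(DI _ _)/(fin _ s0); apply; rewrite unitmxZ ?unitfE.
have [|/existsNP[f2 /not_implyP[If2 /eqP f2s]]] :=
  pselect (forall p, I p -> rat_eval (- s *: g) p = 0).
  have ns0 : - s != 0 by rewrite oppr_eq0.
  by move/(DI _ _)/(fin _ ns0); apply; rewrite unitmxZ ?unitfE.
(* [f1] is nonzero at [s *: g], hence zero at [- s *: g], and conversely for [f2]; so [f1 + f2] is
   nonzero at both points, a contradiction. *)
have If : I (f1 + f2) by move=> h Dh; rewrite rmorphD /= If1 // If2 // addr0.
exfalso; have := nz _ If; have := nz _ If2; have := nz _ If1; clear nz.
move: (rat_eval (s *: g)) (rat_eval (- s *: g)) f1s f2s => u v uf1 vf2.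
move/eqP; rewrite mulf_eq0 (negPf uf1) => /eqP vf1.
move/eqP; rewrite mulf_eq0 (negPf vf2) orbF => /eqP uf2.
by move/eqP; rewrite !rmorphD vf1 uf2 addr0 add0r mulf_eq0 (negPf uf1) (negPf vf2).
Qed.

End Homotheties.

(** * Mumford-Tate groups *)

Section Bilinear.
Variables (K : comNzRingType) (d : nat).
Implicit Types (M N g h : 'M[K]_d) (v w : 'cV[K]_d).

Definition bform M v w : K := (v^T *m M *m w) 0 0.

Lemma bform0l M w : bform M 0 w = 0.
Proof. by rewrite /bform trmx0 !mul0mx mxE. Qed.

Lemma bform0r M v : bform M v 0 = 0.
Proof. by rewrite /bform mulmx0 mxE. Qed.

Lemma bformDl M u v w : bform M (u + v) w = bform M u w + bform M v w.
Proof. by rewrite /bform raddfD /= !mulmxDl mxE. Qed.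

Lemma bformDr M u v w : bform M u (v + w) = bform M u v + bform M u w.
Proof. by rewrite /bform mulmxDr mxE. Qed.

Lemma bformZ M a b v w : bform M (a *: v) (b *: w) = a * b * bform M v w.
Proof.
by rewrite /bform [(a *: v)^T]linearZ /= -!scalemxAl -scalemxAr scalerA mxE.
Qed.

Lemma bform_mul M g h v w : bform M (g *m v) (h *m w) = bform (g^T *m M *m h) v w.
Proof. by rewrite /bform trmx_mul !mulmxA. Qed.

Lemma bform_ext M N : (forall v w, bform M v w = bform N v w) -> M = N.
Proof.
move=> MN; apply/matrixP=> i j; have := MN (delta_mx i 0) (delta_mx j 0).
have pick A : bform A (delta_mx i 0) (delta_mx j 0) = A i j.
  by rewrite /bform trmx_delta -rowE -colE !mxE.
by rewrite !pick.
Qed.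

End Bilinear.

Section Negation.
Variables (K : fieldType) (d : nat).

Lemma connected_oppmx (A : set 'M[K]_d) : connected (A : set (zariski K d)) ->
  connected ([set - g | g in A] : set (zariski K d)).
Proof.
move=> cA; apply: (@connected_continuous_connected (zariski K d) (zariski K d)
  A (fun g : 'M[K]_d => - g)) => //.
apply: continuous_subspaceT; apply/continuousP => _ [S ->].
(* The preimage is cut out by the pullbacks of the members of [S] under negation. *)
exists [set h | exists2 p, S p & forall g, mxeval h g = mxeval p ((- 1%:M) *m g)].
apply/seteqP; split=> g /=.
  move=> [p Sp pg]; have [h hE] := mxeval_mulmxl (- 1%:M) p.
  by exists h; [exists p|rewrite hE mulNmx mul1mx].
by move=> [h [p Sp hE]]; rewrite hE mulNmx mul1mx; exists p.
Qed.

End Negation.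

(** * Hodge decompositions and isometries acting by scalars on them *)

Section HodgeTensors.
Variables (R : realType) (V : vectType rat) (n : int) (H : hodge_structure R V n).
Local Notation C := R[i].
Local Notation d := (\dim {:V}).

Lemma hodge_ind (P : VC R V -> Prop) : P 0 ->
  (forall u v, P u -> P v -> P (u + v)) -> (forall p v, v \in H p -> P v) ->
  forall v, P v.
Proof.
move=> P0 PD PH v; have [s [_ _ _ full]] := hodge_decomposition H.
have : v \in fullv by exact: memvf.
rewrite -full (big_nth 0) big_mkord => /memv_sumP[vs vsP ->].
by apply: big_ind => // i _; apply: PH (vsP i isT).
Qed.

Lemma hodge_mx_ext (g h : 'M[C]_d) :
  (forall p v, v \in H p -> g *m v = h *m v) -> g = h.
Proof.
move=> gh; have ghv (v : 'cV[C]_d) : g *m v = h *m v.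
  apply: (hodge_ind (P := fun v => g *m v = h *m v)) => //.
    by rewrite !mulmx0.
  by move=> u w Pu Pw; rewrite !mulmxDr Pu Pw.
by apply/matrixP=> i j; have /colP/(_ i) := ghv (delta_mx j 0); rewrite -!colE !mxE.
Qed.

(* x k is the projector of V (x) C onto H (p k) along the other summands. *)
Lemma hodge_projectors : exists (s : nat) (p : 'I_s -> int) (x : {ffun 'I_s -> 'M[C]_d}),
  forall (c : int -> C) q v, v \in H q -> (\sum_k c (p k) *: x k) *m v = c q *: v.
Proof.
have [s [us sup dir full]] := hodge_decomposition H.
pose p (k : 'I_(size s)) := nth 0 s k.
have dirI : directv (\sum_(k < size s) H (p k)).
  move: dir; rewrite !directvE /= (big_nth 0) big_mkord => /eqP ->.
  by rewrite (big_nth 0) big_mkord.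
have cap0 := directv_sumP dirI.
pose f k := daddv_pi (H (p k)) (\sum_(j < size s | true && (j != k)) H (p j)).
have fid k v : v \in H (p k) -> f k v = v.
  by move=> vk; apply: daddv_pi_id => //; exact: cap0.
have f0 k j v : j != k -> v \in H (p j) -> f k v = 0.
  move=> jk vj; set W := (\sum_(j < size s | true && (j != k)) H (p j))%VS.
  have vW : v \in W by rewrite (subvP (sumv_sup j _ (subvv _))).
  have cap : (H (p k) :&: W)%VS = 0%VS by exact: cap0.
  have capC : (W :&: H (p k))%VS = 0%VS by rewrite capvC.
  have vUW : v \in (H (p k) + W)%VS by rewrite (subvP (addvSr _ _)).
  have := daddv_pi_add cap vUW; rewrite [X in _ + X]daddv_pi_id // => fv.
  by apply: (addIr v); rewrite add0r.
pose x : {ffun 'I_(size s) -> 'M[C]_d} :=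
  [ffun k => \matrix_(i, j) (f k (delta_mx j 0 : VC R V)) i 0].
exists (size s), p, x.
have xE k v : x k *m v = f k v.
  rewrite ffunE; apply/colP=> i; rewrite !mxE.
  have {2}-> : v = \sum_j v j 0 *: delta_mx j 0.
    rewrite {1}(matrix_sum_delta v); apply: eq_bigr => j _.
    by rewrite big_ord1.
  rewrite linear_sum summxE; apply: eq_bigr => j _.
  by rewrite linearZ !mxE mulrC.
move=> c q v vq; rewrite mulmx_suml.
have [qs|qNs] := boolP (q \in s); last first.
  move: vq; rewrite sup // memv0 => /eqP ->; rewrite scaler0 big1 // => k _.
  by rewrite mulmx0.
have lt_q : (index q s < size s)%N by rewrite index_mem.
pose k0 := Ordinal lt_q; have pk0 : p k0 = q by rewrite /p nth_index.
rewrite (bigD1 k0 isT) big1 => [|k /= kk0].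
  rewrite -scalemxAl xE fid pk0; last exact: vq.
  exact: addr0.
rewrite -scalemxAl xE (@f0 k k0) ?scaler0 //; first by rewrite eq_sym.
by rewrite pk0.
Qed.

Section Polarization.
Variable psi : {biscalar V}.
Hypothesis polH : polarization H psi.
Local Notation q := (gram psi).
Local Notation qC := (map_mx ratr q : 'M[C]_d).

Lemma formCE v w : formC psi v w = bform qC v w.
Proof. by []. Qed.

Lemma IsoE : Iso psi = @isoQ R _ q.
Proof.
apply/seteqP; split=> g [gu gP]; split; try exact: gu.
  by apply: bform_ext => v w; rewrite -bform_mul -!formCE gP.
by move=> v w; rewrite !formCE bform_mul gP.
Qed.

(** By positivity a zero form forces every [H p], hence [V], to be zero. *)
Lemma gram0_trivial : q = 0 -> forall g h : 'M[C]_d, g = h.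
Proof.
move=> q0 g h; have [_ _ pos] := polH; apply: hodge_mx_ext => p v vp.
have [->|v0] := eqVneq v 0; first by rewrite !mulmx0.
by have := pos p v vp v0; rewrite /formC q0 raddf0 mulmx0 mul0mx mxE mulr0 ltxx.
Qed.

(** [H p] and [H r] are orthogonal unless [p + r = n], where the two factors have product 1. The
    inverse acts through the inverse factors. *)
Lemma hodge_iso (c : int -> C) (g : 'M[C]_d) :
  (forall p, c p * c (n - p) = 1) -> (forall p v, v \in H p -> g *m v = c p *: v) ->
  @isoQ R _ q g.
Proof.
move=> cn gP; have [_ orth _] := polH.
have gq : g^T *m qC *m g = qC.
  apply: bform_ext => v w; rewrite -bform_mul; move: v w.
  apply: (hodge_ind (P := fun v => forall w, bform qC (g *m v) (g *m w) = bform qC v w)).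
  - by move=> w; rewrite mulmx0 !bform0l.
  - by move=> u v Pu Pv w; rewrite mulmxDr !bformDl Pu Pv.
  move=> p v vp; apply: (hodge_ind (P := fun w => bform qC (g *m v) (g *m w) = bform qC v w)).
  - by rewrite mulmx0 !bform0r.
  - by move=> u w Pu Pw; rewrite mulmxDr !bformDr Pu Pw.
  move=> r w wr; rewrite (gP _ _ vp) (gP _ _ wr) bformZ.
  have [prn|prn] := eqVneq (p + r) n.
    have -> : r = n - p by rewrite -prn [p + r]addrC addrK.
    by rewrite cn mul1r.
  by rewrite -formCE (orth p r v w vp wr prn) mulr0.
split; last exact: gq.
have c0 p : c p != 0.
  apply/eqP => cp0; have /eqP := cn p.
  by rewrite cp0 mul0r eq_sym oner_eq0.
have [s [p [x xP]]] := hodge_projectors.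
have : g *m (\sum_k (c (p k))^-1 *: x k) = 1%:M.
  apply: hodge_mx_ext => r v vr; rewrite -mulmxA (xP (fun p => (c p)^-1) r v vr).
  by rewrite -scalemxAr (gP _ _ vr) scalerA mulVf // scale1r mul1mx.
by case/mulmx1_unit.
Qed.

End Polarization.

(** * Homotheties in the Mumford-Tate group and a connected subgroup *)

Section MumfordTate.
Variable psi : {biscalar V}.
Hypothesis polH : polarization H psi.
Hypothesis Gm_MT : n = 0 -> Gm_Id `<=` MT H psi.
Local Notation q := (gram psi).

(** Complex conjugation fixes the rational coefficients of the equations. *)
Lemma conj_algebraic (G : set 'M[C]_d) g : algebraic_subgroupQ G ->
  G g -> G (map_mx Num.conj g).
Proof.
case=> _ _ _ [S ->] [gu gP]; split; first by rewrite map_unitmx.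
move=> p Sp; rewrite mxeval_map_ratr -(rmorph_evalQ ratr) -mxeval_map_ratr gP //.
exact: rmorph0.
Qed.

Lemma ex_mu z : z != 0 -> exists g, mu H z g.
Proof.
move=> z0; have [s [p [x xP]]] := hodge_projectors.
by exists (\sum_k z ^ (- p k) *: x k) => r v vr; rewrite (xP (fun p => z ^ (- p)) r v vr).
Qed.

(** By Hodge symmetry the conjugate of [h] acts on [H p] as [z ^ (- (n - p))], while [g] acts as
    [z ^ (- p)]. *)
Lemma mu_conj z g h : z != 0 -> mu H z g -> mu H z^* h ->
  g *m map_mx Num.conj h = (z ^ (- n))%:M.
Proof.
move=> z0 gz hz; apply: hodge_mx_ext => p v vp.
have cvp := hodge_symmetry vp.
have hv : map_mx Num.conj h *m v = z ^ (- (n - p)) *: v.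
  have -> : v = map_mx Num.conj (conjVC v).
    by apply/matrixP=> i j; rewrite !mxE conjCK.
  rewrite -map_mxM (hz _ _ cvp) map_mxZ; congr (_ *: _).
  by rewrite fmorphXz /= conjCK.
rewrite -mulmxA hv -scalemxAr (gz _ _ vp) scalerA mul_scalar_mx.
by rewrite -expfzDr // -opprD subrK.
Qed.

Lemma homothety_in_MT : Gm_Id `<=` MT H psi.
Proof.
(* In weight zero [mu_conj] only produces the identity; in all other weights every scalar is some
   [z ^ (- n)]. *)
have [n0|n0] := eqVneq n 0; first exact: Gm_MT.
move=> _ [t /= t0 <-] G [algG _ muG].
have [z z0 zn] : exists2 z : C, z != 0 & z ^ (- n) = t.
  case: n n0 => [[|m]|m] // _.
    exists ((m.+1).-root t)^-1; first by rewrite invr_eq0 rootC_eq0.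
    by rewrite -exprz_inv invrK -exprnP rootCK.
  by exists ((m.+1).-root t); [rewrite rootC_eq0|rewrite NegzE opprK -exprnP rootCK].
have zc0 : z^* != 0 by rewrite conjC_eq0.
have [g gz] := ex_mu z0; have [h hz] := ex_mu zc0.
rewrite -zn -(mu_conj z0 gz hz); have [_ GM _ _] := algG.
apply: GM; first by apply: muG; exists z.
by apply: conj_algebraic => //; apply: muG; exists z^*.
Qed.

Lemma DH_algebraic : algebraic_subgroupQ (DH H psi).
Proof.
have [I1 IM IV [S IE]] := isoQ_algebraic R q.
rewrite /DH IsoE; split.
- by split=> // G [[]].
- move=> g h [gM gI] [hM hI]; split; last exact: IM.
  by move=> G HG; have [[_ GM _ _] _ _] := HG; apply: GM; [exact: gM|exact: hM].
- move=> g [gM gI]; split; last exact: IV.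
  by move=> G HG; have [[_ _ GV _] _ _] := HG; apply: GV; exact: gM.
(* All rational polynomials vanishing on the group are taken; they include the equations of every
   member of the family and of [isoQ]. *)
exists [set p | forall g, (MT H psi `&` @isoQ R _ q) g -> mxeval (map_mpoly ratr p) g = 0].
apply/seteqP; split=> g; first by move=> gD; split=> [|p]; [case: gD => _ []|exact].
move=> [gu gP]; split.
  move=> G HG; have [[_ _ _ [T GE]] _ _] := HG; rewrite GE; split=> // p Tp.
  by apply: gP => h [hM _]; have := hM G HG; rewrite GE => -[_]; exact.
rewrite IE; split=> // p Sp; apply: gP => h [_]; rewrite IE => -[_]; exact.
Qed.

Lemma sign_expz_odd (r : int) : odd `|n|%N -> (-1 : C) ^ (n - r *+ 2) = -1.
Proof.
have N1 : (-1 : C) != 0 by rewrite oppr_eq0 oner_eq0.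
rewrite expfzDr // -mulr_natl natz -mulrN -exprz_exp -exprnP sqrrN expr1n.
rewrite exp1rz mulr1; case: n => m /=.
  by move=> om; rewrite -exprnP -signr_odd om.
by move=> om; rewrite NegzE -exprz_inv invrN1 -exprnP -signr_odd /= om.
Qed.

(** [D] is the hull for the weights [n - 2p]. The cocharacter with value [z ^ n] times mu at
    [z ^+ 2] lies in [MT] since homotheties do, and is isometric since its exponents at [p] and
    [n - p] are opposite. *)
Lemma ex_connected_subgroup : exists D : set 'M[C]_d,
  [/\ algebraic_subgroupQ D, D `<=` DH H psi, connected (D : set (zariski C d)),
      mu_image H `<=` mulset Gm_Id D & odd `|n|%N -> D (- 1%:M)].
Proof.
have [s [p [x xP]]] := hodge_projectors.
pose a k := n - p k *+ 2.
pose c (z : C) (r : int) := z ^ (n - r *+ 2).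
have lamP z r v : v \in H r -> lamC a x z *m v = c z r *: v by exact: (xP (c z)).
have MT1 : forall G, algebraic_subgroupQ G -> G `<=` GIso psi -> mu_image H `<=` G ->
  forall z, z != 0 -> G (lamC a x z).
  move=> G algG GI muG z z0; have [_ GM _ _] := algG.
  have z20 : z ^+ 2 != 0 by rewrite expf_neq0.
  have [g gz] := ex_mu z20.
  have -> : lamC a x z = (z ^ n)%:M *m g.
    apply: hodge_mx_ext => r v vr; rewrite (lamP _ _ _ vr) -mulmxA (gz _ _ vr).
    rewrite mul_scalar_mx scalerA; congr (_ *: _).
    by rewrite /c expfzDr // [z ^+ 2]exprnP exprz_exp mulrN -natz mulr_natl.
  apply: GM; last by apply: muG; exists (z ^+ 2).
  have : Gm_Id ((z ^ n)%:M : 'M[C]_d) by exists (z ^ n) => //=; rewrite expfz_neq0.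
  by move/homothety_in_MT; apply.
have lamDH z : z != 0 -> DH H psi (lamC a x z).
  move=> z0; split; first by move=> G [algG GI muG]; exact: MT1.
  rewrite IsoE; apply: (@hodge_iso _ polH (c z)) => [r|r v]; last exact: lamP.
  rewrite /c -expfzDr //; set e := (X in z ^ X); have -> : e = 0; last by [].
  by rewrite /e mulrnBl; ring.
have lam1 : lamC a x 1 = 1%:M.
  apply: hodge_mx_ext => r v vr; rewrite (lamP _ _ _ vr) /c exp1rz scale1r.
  by rewrite mul1mx.
have lamV z : z != 0 -> lamC a x z *m lamC a x z^-1 = 1%:M.
  move=> z0; apply: hodge_mx_ext => r v vr.
  rewrite -mulmxA (lamP _ _ _ vr) -scalemxAr (lamP _ _ _ vr) scalerA mul1mx.
  by rewrite /c exprz_inv -expfzDr // addNr scale1r.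
have cx : cochar a (DH H psi) x.
  split; first by rewrite -lamC_ratr rmorph1.
  move=> r r0; have rr0 : ratr r != 0 :> C by rewrite fmorph_eq0.
  by rewrite -!lamC_ratr fmorphV; split; [exact: lamV|exact: lamDH].
have lamu z : z != 0 -> lamC a x z \in unitmx.
  by move=> z0; exact: (proj1 (mulmx1_unit (lamV z z0))).
have lamD z : z != 0 -> cochar_hull a (DH H psi) (lamC a x z).
  by move=> z0; apply: hull_lamC.
exists (cochar_hull a (DH H psi)); split.
- exact: (hull_algebraic a DH_algebraic).
- exact: (hull_sub DH_algebraic).
- exact (@hull_connected _ _ _ a _ DH_algebraic).
(* The weights are doubled, so recovering mu at [z] takes a square root [w]: it is [w ^ (- n)] times
   the value at [w]. *)
- move=> g [z z0 gz]; pose w := sqrtC z.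
  have w2 : w ^+ 2 = z by rewrite sqrtCK.
  have w0 : w != 0 by rewrite sqrtC_eq0.
  exists ((w ^ (- n))%:M); first by exists (w ^ (- n)) => //=; rewrite expfz_neq0.
  exists (lamC a x w); first exact: lamD.
  apply: hodge_mx_ext => r v vr; rewrite (gz _ _ vr) -mulmxA (lamP _ _ _ vr).
  rewrite mul_scalar_mx scalerA; congr (_ *: _).
  by rewrite /c -expfzDr // -w2 [w ^+ 2]exprnP exprz_exp addKr mulrN -natz mulr_natl.
move=> nodd; have -> : - 1%:M = lamC a x (-1).
  apply: hodge_mx_ext => r v vr; rewrite (lamP _ _ _ vr) mulNmx mul1mx.
  by rewrite /c sign_expz_odd ?scaleN1r.
by apply: lamD; rewrite oppr_eq0 oner_eq0.
Qed.

Lemma MT_mul g h : MT H psi g -> MT H psi h -> MT H psi (g *m h).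
Proof.
by move=> gM hM G HG; have [[_ GM _ _] _ _] := HG; apply: GM; [exact: gM|exact: hM].
Qed.

Lemma Iso_homothety (t : C) g : q != 0 -> @isoQ R _ q g -> @isoQ R _ q (t%:M *m g) ->
  t = 1 \/ t = -1.
Proof.
move=> q0 [_ gq] [_]; rewrite mul_scalar_mx [(t *: g)^T]linearZ /=.
rewrite -!scalemxAl -scalemxAr gq scalerA => /eqP.
rewrite -subr_eq0 -[X in _ - X]scale1r -scalerBl scaler_eq0 map_mx_eq0 (negPf q0) orbF.
by rewrite -expr2 subr_eq0 sqrf_eq1 => /orP[] /eqP; [left|right].
Qed.

End MumfordTate.
End HodgeTensors.

(** * Deduction of the four assertions from the connected subgroup *)

Theorem proposition2p1 (R : realType) (V : vectType rat) (n : int)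
    (H : hodge_structure R V n) (psi : {biscalar V})
    (polH : polarization H psi)
    (Gm_MT : n = 0 -> Gm_Id `<=` MT H psi) :
  [/\ (mulset Gm_Id (Hg H psi) =
         mulset Gm_Id (DH H psi) /\
       mulset Gm_Id (DH H psi) = MT H psi),
      DH H psi = Hg H psi `|` mulset [set - 1%:M] (Hg H psi),
      (Hg H psi (- 1%:M) <-> Hg H psi = DH H psi) &
      (odd `|n|%N -> Hg H psi (- 1%:M) /\ Hg H psi = DH H psi)].
Proof.
have [D [algD D_DH cD muD Dodd]] := ex_connected_subgroup polH Gm_MT.
have [D1 _ _ _] := algD.
have GmMT := homothety_in_MT Gm_MT.
have HgDH : Hg H psi `<=` DH H psi.
  exact (@connected_component_sub (zariski R[i] (\dim {:V})) (DH H psi) 1%:M).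
have DHg : D `<=` Hg H psi.
  exact: (@connected_component_max (zariski R[i] (\dim {:V})) (DH H psi) D).
have DI : D `<=` @isoQ R _ (gram psi) by move=> g /D_DH[_]; rewrite IsoE.
have N1DH : DH H psi (- 1%:M).
  split.
    have : Gm_Id (- 1%:M : EndVC R V).
      by exists (-1); [rewrite /= oppr_eq0 oner_eq0|rewrite raddfN].
    exact: (GmMT (- 1%:M)).
  rewrite IsoE; apply: (hodge_iso polH (c := fun=> -1)) => [p|p v _].
    by rewrite mulrNN mulr1.
  by rewrite mulNmx mul1mx scaleN1r.
have DHN h : DH H psi h -> DH H psi (- h).
  move=> hD; have [_ DHM _ _] := DH_algebraic H psi.
  by rewrite -[h]mul1mx -mulNmx; exact: DHM.
(* For a nonzero form the product of [Gm_Id] and [D] belongs to the family whose intersection is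
   [MT]; a zero form means [V = 0]. *)
have MTD : MT H psi `<=` mulset Gm_Id D.
  have [q0|q0] := eqVneq (gram psi) 0.
    move=> g _; rewrite (gram0_trivial polH q0 g (1%:M *m 1%:M)).
    exists 1%:M; last by exists 1%:M; [exact: D1|done].
    by exists 1 => //=; exact: oner_neq0.
  move=> g /(_ (mulset Gm_Id D)); apply; split=> //.
    exact: (homothety_algebraic q0 algD DI).
  move=> _ [_ [t /= t0 <-] [h Dh <-]].
  have := D_DH h Dh => -[_ [hu hP]]; split.
    by rewrite mul_scalar_mx unitmxZ ?unitfE.
  exists (t ^+ 2) => [|v w]; first by rewrite expf_neq0.
  by rewrite -[formC psi v w]hP -!mulmxA !mul_scalar_mx !formCE bformZ expr2.
(* An isometry that is [t] times an element of [D] has [t ^+ 2 = 1], if the form is nonzero. *)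
have DHD g : DH H psi g -> D g \/ exists2 h, D h & g = - h.
  move=> [gM gI]; have [_ [t /= t0 <-] [h Dh gE]] := MTD g gM.
  have [q0|q0] := eqVneq (gram psi) 0.
    by left; rewrite (gram0_trivial polH q0 g 1%:M).
  case: (@Iso_homothety _ _ psi t h q0 (DI h Dh)).
  - by rewrite gE -IsoE.
  - by move=> t1; left; rewrite -gE t1 mul1mx.
  - by move=> t1; right; exists h; rewrite // -gE t1 mul_scalar_mx scaleN1r.
have c_iff : Hg H psi (- 1%:M) <-> Hg H psi = DH H psi.
  split=> [HN1|->//]; apply/seteqP; split=> // g /DHD[/DHg//|[h Dh ->]].
  (* The set of negatives of [D] is connected and contains -1, so it lies in the component of -1,
     here that of 1. *)
  apply: (connected_component_trans HN1).
  apply: (@connected_component_max (zariski R[i] (\dim {:V})) (DH H psi)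
    [set - g | g in D]).
  - by exists 1%:M.
  - by move=> _ [k /D_DH/DHN kD <-].
  - exact: connected_oppmx.
  - by exists h.
split=> //.
- split; apply/seteqP; split=> g.
  + by move=> [t Gt [h /HgDH hD <-]]; exists t => //; exists h.
  + move=> [_ [t /= t0 <-] [h /DHD[Dh|[h' Dh' ->]] <-]].
      by exists t%:M; [exists t|exists h => //; exact: DHg].
    exists (- t)%:M; first by exists (- t) => //=; rewrite oppr_eq0.
    by exists h'; [exact: DHg|rewrite !mul_scalar_mx scaleNr scalerN].
  + by move=> [t /GmMT tM [h [hM _] <-]]; exact: MT_mul.
  + by move=> /MTD[t Gt [h Dh <-]]; exists t => //; exists h => //; exact: D_DH.
- apply/seteqP; split=> g.
  + move=> /DHD[/DHg|[h Dh ->]]; [by left|right].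
    by exists (- 1%:M) => //; exists h; [exact: DHg|rewrite mulNmx mul1mx].
  + by move=> [/HgDH//|[_ -> [h /HgDH/DHN hD <-]]]; rewrite mulNmx mul1mx.
- by move=> nodd; have HN1 := DHg _ (Dodd nodd); split=> //; apply/c_iff.
Qed.
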